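(* Let $d\ge 1$ and, for $1\le i\le d$, let $(X_i,\mathrm{dist}_i,\mu_i)$ be a bounded locally compact metric space with a Borel probability measure $\mu_i$. Put $X=\prod_{i=1}^d X_i$, $\mu=\prod_{i=1}^d\mu_i$, $\mathrm{dist}(x,y)=\max_i \mathrm{dist}_i(x_i,y_i)$. Let $J$, $\beta$, $\{\ell_n,u_n\}$, $J_n$, $\rho=(\rho_1,\dots,\rho_d)$, the resonant sets $\mathfrak R_\alpha=\prod_{i=1}^d\mathfrak R_{\alpha,i}$ ($\alpha\in J$) and $\Psi=(\psi_1,\dots,\psi_d)$ be as described in the context. Assume: (i) each $\mu_i$ is Ahlfors regular with exponent $\delta_i$; (ii) for each $1\le i\le d$, $\{\mathfrak R_{\alpha,i}\}_{\alpha\in J}$ has the $\kappa_i$-scaling property for some $0\le\kappa_i<1$; (iii) $(\{\mathfrak R_\alpha\}_{\alpha\in J},\beta)$ is a ubiquitous system for rectangles with respect to $\rho$ and $\{\ell_n,u_n\}$; (iv) each $\psi_i$ is non-increasing; (v) either every $\psi_i$ ($1\le i\le d$) is $\lambda$-regular with respect to $\{u_n\}$, or every $\rho_i$ ($1\le i\le d$) is $\lambda$-regular with respect to $\{u_n\}$, for some $0<\lambda<1$; (vi) $\psi_i(u_n)\le\rho_i(u_n)$ for all $1\le i\le d$ and all sufficiently large $n$. Then $$\mu(\mathcal W(\Psi))=\mu(X)\quad\text{if}\quad \sum_{n\ge1}\prod_{i=1}^d\left(\frac{\psi_i(u_n)}{\rho_i(u_n)}\right)^{\delta_i(1-\ka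ppa_i)}=\infty.$$
   Context: Balls in $X$: $B(x,r)=\prod_{i=1}^dB(x_i,r)$. $J$ is an infinite countable index set and $\beta:J\to\mathbb R_+$ is such that for every $M>1$ the set $\{\alpha\in J:\beta(\alpha)<M\}$ is finite; write $\beta_\alpha=\beta(\alpha)$. $\{\ell_n\},\{u_n\}$ are sequences of integers with $u_n\ge\ell_n\to\infty$, and $J_n=\{\alpha\in J:\ell_n\le\beta(\alpha)\le u_n\}$. Each $\rho_i:\mathbb R_+\to\mathbb R_+$ satisfies $\rho_i(u)\to0$ as $u\to\infty$. For each $i$ and $\alpha\in J$, $\mathfrak R_{\alpha,i}\subset X_i$. For $A\subset X_i$ and $r>0$, $\Delta(A,r)$ denotes the $r$-neighbourhood of $A$ in $X_i$. $\psi_1,\dots,\psi_d$ are positive functions on $\mathbb R_+$, and $$\mathcal W(\Psi)=\Big\{x\in X: x\in\prod_{i=1}^d\Delta\big(\mathfrak R_{\alpha,i},\psi_i(\beta(\alpha))\big)\text{ for infinitely many }\alpha\in J\Big\}.$$ Ahlfors regular with exponent $\delta$: there are $c>0,r_0>0$ with $c^{-1}r^\delta\le\nu(B(x,r))\le cr^\delta$ for all $x$ and $r<r_0$. $\kappa$-scaling property ($0\le\kappa<1$) of $\{\mathfrak R_{\alpha,i}\}_{\alpha\in J}$: there is an absolute constant $c>0$ such that for every $\alpha\in J$, every ball $B(x_i,r)\subset X_i$ with $x_i\in\mathfrak R_{\alpha,i}$, and every $0<\epsilon<r$, $c^{-1}r^{\delta_i\kappa}\epsilon^{\delta_i(1-\kappa)}\le\mu_i(B(x_i,r)\cap\Delta(\mathfrak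 R_{\alpha,i},\epsilon))\le c\,r^{\delta_i\kappa}\epsilon^{\delta_i(1-\kappa)}$. $\lambda$-regular with respect to $\{u_n\}$: $\varphi(u_{n+1})\le\lambda\varphi(u_n)$ for all sufficiently large $n$. Ubiquitous system for rectangles with respect to $\rho$ and $\{\ell_n,u_n\}$: there is a constant $c>0$ such that for every ball $B\subset X$ there is $n_o(B)$ with $\mu\big(B\cap\bigcup_{\alpha\in J_n}\prod_{i=1}^d\Delta(\mathfrak R_{\alpha,i},\rho_i(u_n))\big)\ge c\,\mu(B)$ for all $n\ge n_o(B)$. *)

(* Defs.v *)
From HB Require Import structures.
From mathcomp Require Import all_boot all_order all_algebra.
From mathcomp Require Import all_classical all_reals all_analysis.

Set Implicit Arguments.
Unset Strict Implicit.
Unset Printing Implicit Defensive.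

Import Order.TTheory GRing.Theory Num.Theory.
Import numFieldNormedType.Exports.

Local Open Scope classical_set_scope.
Local Open Scope ring_scope.

(* Measurable types of the library are pointed; a space carrying a probability
   measure is nonempty, so asking for a point is no restriction. *)
#[short(type="pmetricType")]
HB.structure Definition PointedMetric (R : numDomainType) :=
  {T of Metric R T & Pointed T}.

Definition borel {R : numDomainType} (X : pmetricType R) :=
  g_sigma_algebraType (@open X).

Definition bounded_space {R : numDomainType} (X : metricType R) :=
  exists M : R, forall x y : X, mdist x y <= M.

Section product.
Context {R : realType} {d : nat} (X : 'I_d -> pmetricType R).

Definition rectangle (A : forall i, set (X i)) : set (forall i, X i) :=
  [set x | forall i, A i (x i)].

(* For r > 0 this is the open ball of radius r for the maximum distance. *)
Definition pball (x : forall i, X i) (r : R) : set (forall i, X i) :=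
  rectangle (fun i => ball (x i) r).

Definition measurable_rectangles : set (set (forall i, X i)) :=
  [set rectangle A | A in
    [set A | forall i, measurable (A i : set (borel (X i)))]].

Definition prod_space := g_sigma_algebraType measurable_rectangles.

(* The values on measurable rectangles, a pi-system generating the
   sigma-algebra of prod_space, determine mu. *)
Definition is_product_measure
    (mu_ : forall i, probability (borel (X i)) R)
    (mu : {measure set prod_space -> \bar R}) :=
  forall A : (forall i, set (X i)),
    (forall i, measurable (A i : set (borel (X i)))) ->
    mu (rectangle A) = (\prod_(i < d) mu_ i (A i))%E.

End product.

Definition nbhd {R : realType} {X : metricType R} (A : set X) (r : R) : set X :=
  \bigcup_(a in A) ball a r.

Definition ahlfors_regular {R : realType} {X : metricType R}
    (nu : set X -> \bar R) (delta : R) :=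
  exists c r0 : R, [/\ 0 < c, 0 < r0 &
    forall (x : X) (r : R), 0 < r -> r < r0 ->
      ((c^-1 * r `^ delta)%:E <= nu (ball x r))%E /\
      (nu (ball x r) <= (c * r `^ delta)%:E)%E].

(* The radii are restricted to r < r0, as in Ahlfors regularity: for a
   probability measure and delta > 0, the lower bound fails for large r (let
   e tend to r). *)
Definition scaling_property {R : realType} {X : metricType R} {J : Type}
    (nu : set X -> \bar R) (delta kappa : R) (Res : J -> set X) :=
  exists c r0 : R, [/\ 0 < c, 0 < r0 &
    forall (a : J) (x : X) (r e : R), Res a x -> r < r0 -> 0 < e -> e < r ->
      let b := r `^ (delta * kappa) * e `^ (delta * (1 - kappa)) in
      ((c^-1 * b)%:E <= nu (ball x r `&` nbhd (Res a) e))%E /\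
      (nu (ball x r `&` nbhd (Res a) e) <= (c * b)%:E)%E].

Definition regular_wrt {R : realType} (lambda : R) (u : nat -> int)
    (phi : R -> R) :=
  \forall n \near \oo, phi (u n.+1)%:~R <= lambda * phi (u n)%:~R.

Definition window {R : realType} {J : Type} (beta : J -> R) (l u : nat -> int)
    (n : nat) : set J :=
  [set a | (l n)%:~R <= beta a /\ beta a <= (u n)%:~R].

Definition ubiquitous_rectangles {R : realType} {d : nat}
    {X : 'I_d -> pmetricType R} {J : Type}
    (mu : set (forall i, X i) -> \bar R)
    (Res : J -> forall i, set (X i)) (beta : J -> R)
    (rho : 'I_d -> R -> R) (l u : nat -> int) :=
  exists c : R, 0 < c /\
    forall (x : forall i, X i) (r : R), 0 < r ->
      \forall n \near \oo,
        (c%:E * mu (pball x r) <=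
         mu (pball x r `&` \bigcup_(a in window beta l u n)
               rectangle (fun i => nbhd (Res a i) (rho i (u n)%:~R))))%E.

Definition limsup_set {R : realType} {d : nat} {X : 'I_d -> pmetricType R}
    {J : Type} (Res : J -> forall i, set (X i)) (beta : J -> R)
    (psi : 'I_d -> R -> R) : set (forall i, X i) :=
  [set x | infinite_set
     [set a | rectangle (fun i => nbhd (Res a i) (psi i (beta a))) x]].

(* Main.v *)
(* Every ball B of X meets W(Psi) in a fixed proportion of its measure, and a
   density argument in the doubling space X turns this into full measure.

   Inside B, ubiquity at stage n and a maximal disjoint family of boxes with
   sides rho_i(u_n) centred on resonant points give about
   mu(B) / prod_i rho_i(u_n)^delta_i boxes; E_n is the union of the
   psi_i(u_n)-neighbourhoods of the resonant sets cut off by these boxes.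
   Write p_n for the n-th term of the series and s_i = delta_i (1 - kappa_i).
   The scaling property gives mu(E_n) ~ mu(B) p_n.  For k < n, counting the
   boxes of stage n that meet a piece of stage k gives
     mu(E_k n E_n) <~ mu(B) prod_i (psi_i(u_k)/rho_i(u_k) *
       psi_i(u_n)/rho_i(u_n) + psi_i(u_n)/rho_i(u_k))^s_i,
   and by lambda-regularity of Psi or of rho this is at most a constant times
   mu(B) (p_k p_n + theta^(n-k) (p_k + p_n)) for some theta < 1.  The
   Chung-Erdos inequality on windows with sum of p_n in [1, 2] then bounds
   mu(limsup E_n) from below by a multiple of mu(B). *)

Require Import Defs.
From HB Require Import structures.
From mathcomp Require Import all_boot all_order all_algebra.
From mathcomp Require Import all_classical all_reals all_analysis.
From mathcomp Require Import measurable_realfun lra ring.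

Set Implicit Arguments.
Unset Strict Implicit.
Unset Printing Implicit Defensive.

Import Order.TTheory GRing.Theory Num.Theory.
Import numFieldNormedType.Exports.

Local Open Scope classical_set_scope.
Local Open Scope ring_scope.

(** * Finite measure and second-moment inequalities *)

(** When only Psi is regular nothing forces [rho i (u n)] to decrease, so a later box may be wider
    than an earlier one in some coordinates and narrower in others; overlaps are therefore estimated
    one coordinate at a time and multiplied. The cross term psi_i(u_n)/rho_i(u_k) is where the
    regularity alternative enters: it is at most lambda^(n-k) times the ratio psi_i/rho_i of stage k
    if Psi is regular, of stage n if rho is. That ratio factors out of the product, and theta is
    lambda raised to a positive lower bound for the nonzero s_i. Ubiquity is used in the ball of
    half the radius, so that whole boxes stay in B; doubling pays for it. The proportion gained must
    not depend on B, so all constants are made uniform beforehand. The sigma-algebra is generated by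
    measurable rectangles, so measurability of open subsets of X is not given: it comes from the
    total boundedness that a uniform lower bound for the measure of balls provides. Outer
    approximation by open sets, which the density argument needs, follows from it. *)

Definition fprob {R : realType} {d} {T : measurableType d}
  (P : probability T R) (A : set T) : R := fine (P A).

Section fprob.
Context {R : realType} {d : measure_display} {T : measurableType d}.
Variable P : probability T R.
Local Notation m := (fprob P).

Lemma fprobE A : measurable A -> P A = (m A)%:E.
Proof. by move=> mA; rewrite /fprob fineK// fin_num_measure. Qed.

Lemma fprob_ge0 A : 0 <= m A.
Proof. by rewrite /fprob fine_ge0. Qed.

Lemma fprobT : m setT = 1.
Proof. by rewrite /fprob probability_setT. Qed.

Lemma fprob_le A B : measurable A -> measurable B -> A `<=` B -> m A <= m B.
Proof.
move=> mA mB AB; rewrite -lee_fin -!fprobE//.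
by apply: le_measure => //; rewrite inE.
Qed.

Lemma fprob_le1 A : measurable A -> m A <= 1.
Proof. by move=> mA; rewrite -fprobT; apply: fprob_le. Qed.

Lemma fprobD A B : measurable A -> measurable B -> A `<=` B ->
  m (B `\` A) = m B - m A.
Proof.
move=> mA mB AB; apply: EFin_inj; rewrite EFinB -!fprobE//; last exact: measurableD.
rewrite measureD ?setIidr//.
by rewrite ltey_eq fin_num_measure.
Qed.

Lemma fprobC A : measurable A -> m (~` A) = 1 - m A.
Proof. by move=> mA; rewrite -setTD fprobD// fprobT. Qed.

Lemma fprob_bigcup (I : finType) (K : pred I) (F : I -> set T) :
  (forall i, K i -> measurable (F i)) ->
  (forall i j, K i -> K j -> F i `&` F j !=set0 -> i = j) ->
  m (\bigcup_(i in [set` K]) F i) = \sum_(i | K i) m (F i).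
Proof.
move=> mF dF; apply: EFin_inj; rewrite -fprobE; last first.
  by apply: fin_bigcup_measurable => //; exact: finite_finset.
rewrite measure_fin_bigcup//.
rewrite -sumEFin -(@bigfs _ _ _ _ (index_enum I))//.
- by apply: eq_bigr => i Ki; exact: (fprobE (mF i Ki)).
- exact: index_enum_uniq.
- by move=> i _; rewrite mem_index_enum.
Qed.

Lemma fprob_subadditive (I : finType) (K : pred I) (F : I -> set T) (A : set T) :
  measurable A -> (forall i, measurable (F i)) ->
  A `<=` \bigcup_(i in [set` K]) F i ->
  m A <= \sum_(i | K i) m (F i).
Proof.
move=> mA mF AF.
have mU (s : seq I) : measurable (\big[setU/set0]_(i <- s | K i) F i).
  by apply: bigsetU_measurable => i _; exact: mF.
apply: (@le_trans _ _ (m (\big[setU/set0]_(i <- index_enum I | K i) F i))).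
  apply: fprob_le => // x /AF[i Ki Fix].
  by rewrite (bigD1 i)//=; left.
elim: (index_enum I) => [|i s IH]; first by rewrite !big_nil /fprob measure0.
rewrite !big_cons; case: ifP => // Ki.
apply: le_trans (lerD (lexx _) IH).
by rewrite -lee_fin EFinD -!fprobE//; [exact: measureU2|exact: measurableU].
Qed.

Lemma fprob_nondecreasing (F : nat -> set T) (a : R) :
  (forall n, measurable (F n)) ->
  (forall n k, (n <= k)%N -> F n `<=` F k) ->
  a < m (\bigcup_n F n) -> exists n, a < m (F n).
Proof.
move=> mF ndF aF.
have mU : measurable (\bigcup_n F n) by exact: bigcup_measurable.
have h : (P \o F) n @[n --> \oo] --> P (\bigcup_n F n).
  by apply: nondecreasing_cvg_mu => // n k nk; apply/subsetPset; exact: ndF.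
rewrite (fprobE mU) in h.
have /fine_cvgP[_ /cvgr_gt/(_ _ aF)] := h.
by case=> n _ /(_ n (leqnn n)); exists n.
Qed.

Lemma fprob_nonincreasing (F : nat -> set T) (a : R) :
  (forall n, measurable (F n)) ->
  (forall n k, (n <= k)%N -> F k `<=` F n) ->
  (forall n, a <= m (F n)) -> a <= m (\bigcap_n F n).
Proof.
move=> mF niF aF; rewrite leNgt; apply/negP => Fa.
have mI : measurable (\bigcap_n F n) by exact: bigcap_measurable.
have : 1 - a < m (\bigcup_n ~` F n).
  rewrite -setC_bigcap fprobC//; lra.
case/fprob_nondecreasing => [n|n k nk|n]; first exact: measurableC.
- by apply: subsetC; exact: niF.
- by rewrite fprobC//; have := aF n; lra.
Qed.

(** Disjoint sets of measure at least [eta] number at most [eta^-1], so a disjoint family of largest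
    cardinality exists; a point whose set missed all of them could be adjoined. *)
Lemma maximal_disjoint (Q : T -> set T) (G : set T) (eta : R) :
  0 < eta -> (forall x, G x -> measurable (Q x) /\ eta <= m (Q x)) ->
  exists (N : nat) (z : 'I_N -> T), [/\ forall i, G (z i),
    forall i j, Q (z i) `&` Q (z j) !=set0 -> i = j &
    forall x, G x -> exists i, Q x `&` Q (z i) !=set0].
Proof.
move=> eta0 mQ.
pose D n := `[<exists z : 'I_n -> T, (forall i, G (z i)) /\
    forall i j, Q (z i) `&` Q (z j) !=set0 -> i = j>].
have D0 : D 0%N.
  apply/asboolP; exists (fun=> point); split; first by case.
  by case.
have Dbound n : D n -> (n <= Num.bound eta^-1)%N.
  move=> /asboolP[z [Gz dz]].
  have : \sum_(i < n) m (Q (z i)) <= 1.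
    rewrite -fprob_bigcup; last 2 first.
    - by move=> i _; case: (mQ _ (Gz i)).
    - by move=> i j _ _; exact: dz.
    apply: fprob_le1; apply: fin_bigcup_measurable; first exact: finite_finset.
    by move=> i _; case: (mQ _ (Gz i)).
  have : \sum_(i < n) eta <= \sum_(i < n) m (Q (z i)).
    by apply: ler_sum => i _; case: (mQ _ (Gz i)).
  rewrite sumr_const card_ord -mulr_natl => h1 h2.
  have h3 : n%:R <= eta^-1 by rewrite -(ler_pM2r eta0) mulVf ?gt_eqF// (le_trans h1).
  have := archi_boundP (ltW (_ : 0 < eta^-1)); rewrite invr_gt0 => /(_ eta0) h4.
  by rewrite -(ler_nat R) (le_trans h3)// ltW.
have [N /asboolP[z [Gz dz]] Nmax] := ex_maxnP (ex_intro (fun n => D n) _ D0) Dbound.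
exists N, z; split => // x Gx; apply: contrapT => nx.
suff : (N.+1 <= N)%N by rewrite ltnn.
apply: Nmax; apply/asboolP.
(* The family with [x] adjoined as its last member. *)
exists (fun i => if unlift ord_max i is Some j then z j else x).
have nz i : ~ (Q x `&` Q (z i) !=set0) by move=> ?; apply: nx; exists i.
split=> [i|i j].
  by case: unliftP.
case: unliftP => [k ->|->]; case: unliftP => [l ->|->] //.
- by move=> /dz ->.
- by rewrite setIC => /nz.
- by move=> /nz.
Qed.

(* With [S] the sum of the indicators, [(1 - t S)^2 >= 0] yields
   [2 t S - t^2 S^2 <= 1_U]; integrating this replaces the Cauchy-Schwarz
   inequality in the Chung-Erdos argument. *)
Lemma chung_erdos (I : eqType) (s : seq I) (E : I -> set T) (U : set T) (t : R) :
  0 <= t -> (forall i, measurable (E i)) -> measurable U ->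
  (forall i, i \in s -> E i `<=` U) ->
  2 * t * (\sum_(i <- s) m (E i)) <=
    m U + t ^+ 2 * \sum_(i <- s) \sum_(j <- s) m (E i `&` E j).
Proof.
move=> t0 mE mU EU.
have mI (A : set T) : measurable A ->
    measurable_fun [set: T] (fun x => (\1_A x)%:E : \bar R).
  by move=> mA; apply/measurable_EFinP; exact: measurable_indic.
have eI (A : set T) : measurable A -> (\int[P]_x (\1_A x)%:E = (m A)%:E)%E.
  by move=> mA; rewrite integral_indic// setIT; exact: fprobE.
have mEI i j : measurable (E i `&` E j) by exact: measurableI.
have s0 (A : set T) x : (0 <= (\1_A x)%:E :> \bar R)%E.
  by rewrite lee_fin indicE.
have : (\int[P]_x ((2 * t)%:E * \sum_(i <- s) (\1_(E i) x)%:E) <=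
   \int[P]_x ((\1_U x)%:E + (t ^+ 2)%:E *
      \sum_(i <- s) \sum_(j <- s) (\1_(E i `&` E j) x)%:E))%E.
  apply: ge0_le_integral => //.
  - move=> x _; apply: mule_ge0; first by rewrite lee_fin mulr_ge0.
    exact: sume_ge0.
  - apply: emeasurable_funM => //.
    by apply: emeasurable_sum => i; exact: mI.
  - apply: emeasurable_funD; first exact: mI.
    apply: emeasurable_funM => //.
    apply: emeasurable_sum => i.
    by apply: emeasurable_sum => j; exact: mI.
  move=> x _; under [in leRHS]eq_bigr do rewrite sumEFin.
  rewrite !sumEFin -!EFinM -EFinD lee_fin.
  under [in leRHS]eq_bigr do under eq_bigr do rewrite indicI/=.
  under [in leRHS]eq_bigr do rewrite -mulr_sumr.
  rewrite -mulr_suml; set S := \sum_(i <- s) _.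
  have [Ux|Ux] := pselect (U x).
    rewrite indicE mem_set//=; have := sqr_ge0 (1 - t * S); nra.
  suff -> : S = 0 by rewrite !mulr0 addr0 indicE.
  rewrite /S big_seq big1// => i /EU EUi.
  by rewrite indicE memNset// => /EUi.
rewrite ge0_integralZl_EFin//; last 3 first.
- by move=> x _; exact: sume_ge0.
- by apply: emeasurable_sum => i; exact: mI.
- by rewrite mulr_ge0.
rewrite ge0_integral_sum//; last by move=> i; exact: mI.
rewrite ge0_integralD//; last 3 first.
- exact: mI.
- move=> x _; apply: mule_ge0; first by rewrite lee_fin sqr_ge0.
  by apply: sume_ge0 => i _; exact: sume_ge0.
- apply: emeasurable_funM => //; apply: emeasurable_sum => i.
  by apply: emeasurable_sum => j; exact: mI.
rewrite ge0_integralZl_EFin//; last 3 first.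
- by move=> x _; apply: sume_ge0 => i _; exact: sume_ge0.
- apply: emeasurable_sum => i.
  by apply: emeasurable_sum => j; exact: mI.
- by rewrite sqr_ge0.
rewrite ge0_integral_sum//; last 2 first.
- by move=> i; apply: emeasurable_sum => j; exact: mI.
- by move=> i x _; exact: sume_ge0.
rewrite eI//; under eq_bigr do rewrite eI//.
under [in leRHS]eq_bigr.
  move=> i _; rewrite ge0_integral_sum//; last by move=> j; exact: mI.
  under eq_bigr do rewrite eI//.
  rewrite sumEFin; over.
by rewrite !sumEFin -!EFinM -EFinD lee_fin.
Qed.

End fprob.

(** * Regularity and density with respect to abstract balls *)

Section ball_regularity.
Context {R : realType} {d : measure_display} {T : measurableType d}.
Variables (P : probability T R) (B : T -> R -> set T).
Local Notation m := (fprob P).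

(** Openness relative to the abstract balls [B], so that no topology on [T] is needed. *)
Definition ball_open_set (G : set T) :=
  forall x, G x -> exists2 r : R, 0 < r & B x r `<=` G.

Hypothesis B_center : forall x (r : R), 0 < r -> B x r x.
Hypothesis B_sym : forall x y r, B x r y -> B y r x.
Hypothesis B_triangle : forall x y z r s,
  B x r y -> B y s z -> B x (r + s) z.
Hypothesis B_open : forall x r, ball_open_set (B x r).
Hypothesis B_measurable : forall x r, measurable (B x r).
Hypothesis B_pos : forall r : R, 0 < r ->
  exists2 eta : R, 0 < eta & forall x, eta <= m (B x r).

Lemma ball_le x r s : r <= s -> B x r `<=` B x s.
Proof.
rewrite le_eqVlt => /orP[/eqP->//|rs y xy].
have -> : s = r + (s - r) by ring.
by apply: B_triangle xy _; apply: B_center; rewrite subr_gt0.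
Qed.

Lemma ball_half x y z r : B x (r / 2) z -> B y (r / 2) z -> B x r y.
Proof.
by move=> xz /B_sym zy; rewrite [r]splitr; exact: B_triangle xz zy.
Qed.

(** Total boundedness without compactness: balls of radius [r / 2] have measure bounded below, so a
    maximal disjoint family of them is finite, and doubling its radii covers [T]. *)
Lemma finite_net r : 0 < r ->
  exists N (z : 'I_N -> T), forall x, exists i, B (z i) r x.
Proof.
move=> r0; have r20 : 0 < r / 2 by rewrite divr_gt0.
have [eta eta0 Beta] := B_pos r20.
have [|N [z [_ _ zmax]]] :=
  @maximal_disjoint R d T P (fun x => B x (r / 2)) setT eta eta0.
  by move=> x _; split.
exists N, z => x; have [//|i [y [xy iy]]] := zmax x.
by exists i; exact: ball_half iy xy.
Qed.

Lemma invS_gt0 n : 0 < n.+1%:R^-1 :> R.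
Proof. by rewrite invr_gt0. Qed.

Lemma invS_lt (e : R) : 0 < e -> exists n : nat, n.+1%:R^-1 < e.
Proof.
move=> e0; have [n _ /(_ n (leqnn n))] := near_infty_natSinv_lt (PosNum e0).
by exists n.
Qed.

(** A point [y] of [B x r] outside [G] still lies in [B z r] for [z] near [x], because [B y r] is
    open around [x]. *)
Lemma ball_open_setC_inner G r : ball_open_set (~` [set x | B x r `<=` G]).
Proof.
move=> x /= /existsNP[y /not_implyP[xy Gy]].
have [s s0 sB] := B_open (B_sym xy).
exists s => // z /sB yz zG; apply: Gy; apply: zG; exact: B_sym.
Qed.

(** Only balls are assumed measurable: [G] is recovered as the countable union of those balls of the
    finite nets of radius [1/(n+1)] that lie inside it. *)
Lemma ball_open_set_measurable G : ball_open_set G -> measurable G.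
Proof.
move=> oG.
have h n := finite_net (invS_gt0 n).
have [N HN] := choice h.
have [z Hz] : {z : forall n, 'I_(N n) -> T |
    forall n x, exists i, B (z n i) n.+1%:R^-1 x}.
  by exists (fun n => projT1 (cid (HN n))) => n x; case: cid.
have -> : G = \bigcup_n \bigcup_(i in
    [set i | B (z n i) n.+1%:R^-1 `<=` G]) B (z n i) n.+1%:R^-1.
  apply/seteqP; split => [x Gx|x [n _ [i /= iG]]]; last exact: iG.
  have [r r0 rG] := oG x Gx.
  have [n nr] := @invS_lt (r / 2) (divr_gt0 r0 (ltr0Sn R 1)).
  have [i ix] := Hz n x.
  exists n => //; exists i => //= y iy; apply: rG.
  apply: (@ball_le _ (n.+1%:R^-1 + n.+1%:R^-1)).
    by rewrite [r]splitr lerD// ltW.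
  exact: B_triangle (B_sym ix) iy.
by apply: bigcup_measurable => n _; exact: fin_bigcup_measurable.
Qed.

Lemma inner_measurable G r : measurable [set x | B x r `<=` G].
Proof.
rewrite -[X in measurable X]setCK; apply: measurableC.
exact/ball_open_set_measurable/ball_open_setC_inner.
Qed.

(** By openness the inner sets increase to [G] as the radius decreases to 0; continuity from below
    does the rest. *)
Lemma inner_lt G (a : R) : ball_open_set G -> a < m G ->
  exists2 r, 0 < r & forall s, s <= r -> a < m [set x | B x s `<=` G].
Proof.
move=> oG aG.
pose F n := [set x | B x n.+1%:R^-1 `<=` G].
have [|n k nk x nG||n an] := @fprob_nondecreasing _ _ _ P F a.
- by move=> n; exact: inner_measurable.
- apply: subset_trans nG; apply: ball_le.
  by rewrite lef_pV2 ?posrE// ler_nat.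
- suff -> : \bigcup_n F n = G by [].
  apply/seteqP; split => [x [n _]|x Gx]; first by apply; exact/B_center/invS_gt0.
  have [r r0 rG] := oG x Gx; have [n nr] := invS_lt r0.
  by exists n => //; apply: subset_trans rG; exact/ball_le/ltW.
exists n.+1%:R^-1 => [|s sn]; first exact: invS_gt0.
apply: (lt_le_trans an); apply: fprob_le; [exact: inner_measurable..|].
by move=> x /= nG; apply: subset_trans nG; exact: ball_le.
Qed.

Definition regular_set (A : set T) := measurable A /\
  forall e, 0 < e -> exists F G, [/\ ball_open_set (~` F), ball_open_set G,
    F `<=` A, A `<=` G & m (G `\` F) < e].

Lemma ball_open_set_bigcup (I : Type) (D : set I) (G : I -> set T) :
  (forall i, ball_open_set (G i)) -> ball_open_set (\bigcup_(i in D) G i).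
Proof.
move=> oG x [i Di /oG[r r0 rG]]; exists r => // y /rG Gy.
by exists i.
Qed.

Lemma ball_open_setI G H :
  ball_open_set G -> ball_open_set H -> ball_open_set (G `&` H).
Proof.
move=> oG oH x [/oG[r r0 rG] /oH[s s0 sH]].
exists (Num.min r s); first by rewrite lt_min r0.
move=> y xy; split.
  by apply: rG; apply: ball_le xy; rewrite ge_min lexx.
by apply: sH; apply: ball_le xy; rewrite ge_min lexx orbT.
Qed.

Lemma ball_open_setT : ball_open_set setT.
Proof. by move=> x _; exists 1. Qed.

Lemma ball_open_regular G : ball_open_set G -> regular_set G.
Proof.
move=> oG; have mG := ball_open_set_measurable oG; split=> // e e0.
have [|r r0 /(_ r (lexx r)) rG] := @inner_lt G (m G - e) oG; first by lra.
have mI := inner_measurable G r.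
have IG : [set x | B x r `<=` G] `<=` G by move=> x; apply; exact: B_center.
exists [set x | B x r `<=` G], G; split => //.
  exact: ball_open_setC_inner.
by rewrite fprobD//; lra.
Qed.

Lemma regular_setC A : regular_set A -> regular_set (~` A).
Proof.
move=> [mA rA]; split=> [|e /rA[F [G [oF oG FA AG FG]]]].
  exact: measurableC.
exists (~` G), (~` F); rewrite setCK; split=> //; try exact: subsetC.
by rewrite setDE setCK setIC -setDE.
Qed.

Lemma regular_set_bigcup (A : nat -> set T) :
  (forall n, regular_set (A n)) -> regular_set (\bigcup_n A n).
Proof.
move=> rA; split=> [|e e0].
  by apply: bigcup_measurable => n _; case: (rA n).
(* The errors for the [A n] add up to at most [e / 2]; the other half pays for truncating the union
   of closed sets, which is closed only when finite. *)
have e20 n : 0 < (e / 2) / 2 ^+ n.+1 by rewrite !divr_gt0// exprn_gt0.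
have /choice[F] : forall n, exists FG : set T * set T,
    [/\ ball_open_set (~` FG.1), ball_open_set FG.2, FG.1 `<=` A n,
      A n `<=` FG.2 & m (FG.2 `\` FG.1) < (e / 2) / 2 ^+ n.+1].
  by move=> n; case: (rA n) => _ /(_ _ (e20 n))[F [G ?]]; exists (F, G).
move=> FP.
have mF n : measurable (F n).1.
  rewrite -[X in measurable X]setCK; apply: measurableC.
  by apply: ball_open_set_measurable; case: (FP n).
have mG n : measurable (F n).2.
  by apply: ball_open_set_measurable; case: (FP n).
have mH n : measurable ((F n).2 `\` (F n).1) by exact: measurableD.
have mUG : measurable (\bigcup_n (F n).2) by exact: bigcup_measurable.
have mUF : measurable (\bigcup_n (F n).1) by exact: bigcup_measurable.
pose S n := \bigcup_(i in [set` predT : pred 'I_n]) (F i).1.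
have mS n : measurable (S n) by apply: fin_bigcup_measurable.
have [n Sn] : exists n, m (\bigcup_n (F n).1) - e / 2 < m (S n).
  have US : \bigcup_n (F n).1 = \bigcup_n S n.
    apply/seteqP; split => [x [n _ Fx]|x [n _ [i _ Fx]]].
      by exists n.+1 => //; exists (@Ordinal n.+1 n (ltnSn n)).
    by exists i.
  rewrite US; apply: fprob_nondecreasing => //; last by lra.
  move=> n k nk x [i _ Fx]; exists (widen_ord nk i) => //.
pose H n := \bigcup_(i in [set` predT : pred 'I_n]) ((F i).2 `\` (F i).1).
have Hle k : m (H k) <= e / 2.
  apply: (@le_trans _ _ (\sum_(i < k) (e / 2) / 2 ^+ i.+1)).
    apply: (@le_trans _ _ (\sum_(i < k) m ((F i).2 `\` (F i).1))).
      apply: fprob_subadditive => //.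
      by apply: fin_bigcup_measurable.
    by apply: ler_sum => i _; apply: ltW; case: (FP i).
  have -> : \sum_(i < k) e / 2 / 2 ^+ i.+1 = e / 2 - e / 2 / 2 ^+ k.
    elim: k => [|k IH]; first by rewrite big_ord0 expr0; field.
    rewrite big_ord_recr/= IH exprS; field.
    by rewrite expf_neq0.
  by rewrite gerBl divr_ge0 ?divr_ge0 ?exprn_ge0// ltW.
have GF : m (\bigcup_n (F n).2 `\` \bigcup_n (F n).1) <= e / 2.
  rewrite leNgt; apply/negP => Hlt.
  have [|||k] := @fprob_nondecreasing _ _ _ P H (e / 2).
  - by move=> k; apply: fin_bigcup_measurable.
  - by move=> k j kj x [i _ Fx]; exists (widen_ord kj i).
  - apply: (lt_le_trans Hlt); apply: fprob_le; first exact: measurableD.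
      apply: bigcup_measurable => k _; exact: fin_bigcup_measurable.
    move=> x [[k _ Gx] nFx]; exists k.+1 => //.
    exists (@Ordinal k.+1 k (ltnSn k)) => //; split => //= Fx.
    by apply: nFx; exists k.
  - by rewrite ltNge Hle.
exists (S n), (\bigcup_n (F n).2); split.
- rewrite /S; elim: n {Sn} => [|n IH].
    rewrite (_ : \bigcup_(i in _) _ = set0) ?setC0; first exact: ball_open_setT.
    by apply/seteqP; split => x // [[]].
  suff -> : ~` (\bigcup_(i in [set` predT : pred 'I_n.+1]) (F i).1) =
    ~` (F n).1 `&` ~` (\bigcup_(i in [set` predT : pred 'I_n]) (F i).1).
    by apply: ball_open_setI => //; case: (FP n).
  rewrite -setCU; congr (~` _); apply/seteqP; split => [x [i _ Fx]|x [Fx|[i _ Fx]]].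
  + have := ltn_ord i; rewrite ltnS leq_eqVlt => /orP[/eqP <-|ni]; first by left.
    by right; exists (Ordinal ni).
  + by exists ord_max.
  + by exists (widen_ord (leqnSn n) i).
- by apply: ball_open_set_bigcup => k; case: (FP k).
- by move=> x [i _ Fx]; exists i => //; case: (FP i) => _ _ h _ _; exact: h.
- by move=> x [k _ Ax]; exists k => //; case: (FP k) => _ _ _ h _; exact: h.
- have SF : S n `<=` \bigcup_n (F n).1 by move=> x [i _ Fx]; exists i.
  have FG : \bigcup_n (F n).1 `<=` \bigcup_n (F n).2.
    move=> x [i _ Fx]; exists i => //.
    by case: (FP i) => _ _ h h' _; exact/h'/h.
  rewrite fprobD//; last exact: subset_trans FG.
  by move: GF; rewrite fprobD//; lra.
Qed.

Lemma generated_regular A : <<s ball_open_set >> A -> regular_set A.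
Proof.
apply: smallest_sub => [|G]; last exact: ball_open_regular.
split.
- by apply: ball_open_regular => x [].
- by move=> A' rA; rewrite setTD; exact: regular_setC.
- exact: regular_set_bigcup.
Qed.

(* A substitute for the Lebesgue density theorem: the complement of [E] is
   covered by an open set [G] of almost the same measure, and a maximal
   [r]-separated set of centres with [B x (2 r)] inside [G] gives disjoint balls
   filling a fixed proportion of [G] without any Vitali covering. *)
Lemma full_of_uniform_density (E : set T) (C c r0 : R) :
  0 < C -> 0 < c -> 0 < r0 ->
  (forall x r, 0 < r -> r < r0 -> m (B x r) <= C * m (B x (r / 2))) ->
  <<s ball_open_set >> E ->
  (forall x r, 0 < r -> r < r0 -> c * m (B x r) <= m (E `&` B x r)) ->
  m E = 1.
Proof.
move=> C0 c0 r00 Bdoubling gE Edense.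
have mE : measurable E by case: (generated_regular gE).
apply/eqP; rewrite eq_le fprob_le1//= leNgt; apply/negP => E1.
pose a := 1 - m E.
have a0 : 0 < a by rewrite subr_gt0.
(* Chosen so that [C / c * e = a / 2], which is at most [m G / 2]. *)
pose e := c * a / (2 * C).
have e0 : 0 < e by rewrite divr_gt0// mulr_gt0.
have [_ /(_ _ e0)[F [G [oF oG FE EG GF]]]] := regular_setC (generated_regular gE).
have mG := ball_open_set_measurable oG.
have mF : measurable F.
  rewrite -[X in measurable X]setCK; apply: measurableC.
  exact: ball_open_set_measurable.
have aG : a <= m G by rewrite /a -fprobC//; apply: fprob_le => //; exact: measurableC.
have [|s s0 sG] := @inner_lt G (m G / 2) oG; first by lra.
(* [2 * r <= s] leaves more than half the measure of [G] in [I] below; [r < r0] permits doubling and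
   the density hypothesis. *)
pose r := Num.min s (r0 / 2) / 2.
have r_gt0 : 0 < r by rewrite divr_gt0// lt_min s0 divr_gt0.
have rs : 2 * r <= s by rewrite /r mulrC divfK// ge_min lexx.
have rr0 : r < r0.
  have : 2 * r <= r0 / 2 by rewrite /r mulrC divfK// ge_min lexx orbT.
  lra.
have [eta eta0 Beta] := B_pos (divr_gt0 r_gt0 (ltr0Sn R 1)).
pose I := [set x | B x (2 * r) `<=` G].
have [|N [z [Iz dz zmax]]] :=
  @maximal_disjoint R d T P (fun x => B x (r / 2)) I eta eta0.
  by move=> x _; split.
have h1 : m I <= \sum_(i < N) m (B (z i) r).
  apply: fprob_subadditive => //; first exact: inner_measurable.
  move=> x Ix; have [i [y [xy iy]]] := zmax x Ix.
  by exists i => //; exact: ball_half iy xy.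
have h2 : \sum_(i < N) m (B (z i) r) <= C / c * \sum_(i < N) m (E `&` B (z i) (r / 2)).
  rewrite mulr_sumr; apply: ler_sum => i _.
  apply: (le_trans (Bdoubling _ _ r_gt0 rr0)).
  rewrite -mulrA ler_wpM2l ?(ltW C0)// ler_pdivlMl//.
  by apply: Edense; lra.
(* The disjoint balls lie in [G] and [E] misses [F], so the traces of [E] on them fit into the small
   difference of [G] and [F]. *)
have h3 : \sum_(i < N) m (E `&` B (z i) (r / 2)) <= m (G `\` F).
  rewrite -fprob_bigcup.
  - apply: fprob_le.
    + by apply: fin_bigcup_measurable => // i _; exact: measurableI.
    + exact: measurableD.
    + move=> x [i _ [Ex ix]]; split; last by move=> /FE.
      apply: (Iz i); apply: ball_le ix; lra.
  - by move=> i _; exact: measurableI.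
  - move=> i j _ _ [x [[_ ix] [_ jx]]]; apply: dz; exists x; split => //.
have h4 := sG _ rs.
have h5 : C / c * m (G `\` F) < C / c * e by rewrite ltr_pM2l// divr_gt0.
have h6 : C / c * e = a / 2 by rewrite /e; field; rewrite !gt_eqF.
have h7 : C / c * \sum_(i < N) m (E `&` B (z i) (r / 2)) <= C / c * m (G `\` F).
  by rewrite ler_wpM2l// ltW// divr_gt0.
have : m G / 2 < a / 2.
  rewrite -h6; apply: le_lt_trans h5; apply: le_trans h7.
  by apply: le_trans h2; apply: le_trans h1; exact: ltW.
lra.
Qed.

End ball_regularity.

(** * A quantitative Borel-Cantelli lemma *)

(** Take the least [N] whose sum reaches 1: the sum without its last term is below 1, and that term
    is at most 1. *)
Lemma divergent_window (R : realType) (p : nat -> R) (n0 : nat) :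
  (forall n, 0 <= p n) -> (forall n, (n0 <= n)%N -> p n <= 1) ->
  (\sum_(1 <= n <oo) (p n)%:E = +oo)%E ->
  forall M, (n0 <= M)%N -> exists N, 1 <= \sum_(M <= n < N) p n <= 2.
Proof.
move=> p0 p1 poo M n0M.
have [N N1] : exists N, 1 <= \sum_(M <= n < N) p n.
  apply: contrapT => /forallNP bnd.
  suff : (\sum_(1 <= n <oo) (p n)%:E <= (\sum_(0 <= n < M) p n + 1)%:E)%E.
    by rewrite poo leye_eq.
  apply: lime_le; first by apply: is_cvg_nneseries => n _ _; rewrite lee_fin.
  near=> N; rewrite sumEFin lee_fin.
  apply: (@le_trans _ _ (\sum_(0 <= n < N) p n)).
    have [N0|N0] := leqP 1 N; last by rewrite big_geq ?sumr_ge0//; exact: ltnW.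
    by rewrite [leRHS](big_cat_nat _ N0)//= lerDr big_nat1.
  have [MN|NM] := leqP M N.
    rewrite (big_cat_nat _ MN)//= lerD2l ltW// ltNge.
    by apply/negP; exact: bnd.
  rewrite [in leRHS](big_cat_nat _ (ltnW NM))//= -addrA lerDl addr_ge0//.
  by rewrite sumr_ge0.
have ex : exists N, 1 <= \sum_(M <= n < N) p n by exists N.
have [{N1}N N1 Nmin] := ex_minnP ex; exists N; rewrite N1/=.
have [MN|NM] := ltnP M N; last by move: N1; rewrite big_geq// ler10.
case: N MN N1 Nmin => // N MN N1 Nmin.
rewrite big_nat_recr//= (_ : 2 = 1 + 1)// lerD//.
- rewrite leNgt; apply/negP => /ltW /Nmin; by rewrite ltnn.
- by apply: p1; apply: leq_trans n0M _.
Unshelve. all: by end_near.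
Qed.

(** With truncated subtraction the exponent is [|n - k|], so two geometric series are summed. *)
Lemma sum_expr_dist (R : realType) (th : R) (n N : nat) : 0 <= th -> th < 1 ->
  \sum_(0 <= k < N) th ^+ ((n - k) + (k - n)) <= 2 / (1 - th).
Proof.
move=> th0 th1; have th1' : 0 < 1 - th by rewrite subr_gt0.
rewrite ler_pdivlMr//.
(* Multiplied by [1 - th] the sum telescopes; the two branches are the invariant of the induction on
   [N], before and after [N] passes [n]. *)
suff : (\sum_(0 <= k < N) th ^+ ((n - k) + (k - n))) * (1 - th) <=
    if (N <= n)%N then th ^+ (n.+1 - N) else 2 - th ^+ (N - n).
  move/le_trans; apply; case: ifP => _.
    have : th ^+ (n.+1 - N) <= 1 by apply: exprn_ile1 => //; exact: ltW.
    lra.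
  by rewrite gerBl exprn_ge0.
elim: N => [|N IH]; first by rewrite big_nil mul0r leq0n exprn_ge0.
rewrite big_nat_recr//= mulrDl; apply: le_trans (lerD IH (lexx _)) _.
have [Nn|nN|<-] := ltngtP N n.
- have -> : (N - n = 0)%N by apply/eqP; rewrite subn_eq0 ltnW.
  by rewrite addn0 subSS subSn ?(ltnW Nn)// exprS; lra.
- have -> : (n - N = 0)%N by apply/eqP; rewrite subn_eq0 ltnW.
  by rewrite add0n subSn ?(ltnW nN)// exprS; lra.
- rewrite subnn addn0 expr0 subSnn expr1; lra.
Qed.

(** [b] stands for the measure of the ball in which the construction takes place; the bound is
    linear in it. Every tail union already satisfies the bound, by the second moment on a window
    inside the tail, and continuity from above passes to the limsup. *)
Lemma borel_cantelli_local (R : realType) (d : measure_display)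
  (T : measurableType d) (P : probability T R) (E : nat -> set T)
  (p : nat -> R) (n0 : nat) (c C th b : R) :
  0 < c -> 0 < C -> 0 <= th -> th < 1 -> 0 <= b ->
  (forall n, measurable (E n)) ->
  (forall n, 0 <= p n) -> (forall n, (n0 <= n)%N -> p n <= 1) ->
  (\sum_(1 <= n <oo) (p n)%:E = +oo)%E ->
  (forall n, (n0 <= n)%N -> c * b * p n <= fprob P (E n)) ->
  (forall n, (n0 <= n)%N -> fprob P (E n) <= C * b * p n) ->
  (forall k n, (n0 <= k)%N -> (k < n)%N -> fprob P (E k `&` E n) <=
    C * b * (p k * p n + th ^+ (n - k) * (p k + p n))) ->
  c ^+ 2 / (C * (2 + 4 / (1 - th))) * b <=
    fprob P (\bigcap_N \bigcup_(n in [set n | (N <= n)%N]) E n).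
Proof.
move=> c0 C0 th0 th1 b0 mE p0 p1 poo Elo Eup Eov.
have th1' : 0 < 1 - th by rewrite subr_gt0.
(* With [S] the sum of [p] over the window, the 2 comes from [S * S <= 2 * S], and [4 / (1 - th)]
   from two mixed sums, each at most [S * (2 / (1 - th))]. *)
set D := C * _; have D0 : 0 < D by rewrite mulr_gt0// addr_gt0// divr_gt0.
apply: fprob_nonincreasing => [M|M N MN|M].
- exact: bigcup_measurable.
- by move=> x [n /= Nn En]; exists n => //=; apply: leq_trans Nn.
pose M0 := maxn n0 M.
have [N /andP[N1 N2]] := divergent_window p0 p1 poo (leq_maxl n0 M).
set U := \bigcup_(n in _) _.
have mU : measurable U by exact: bigcup_measurable.
pose S := \sum_(M0 <= n < N) p n.
have t0 : 0 <= c / D by rewrite divr_ge0 ?ltW.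
(* [t = c / D] maximises [2 * t * (c * b * S) - t ^+ 2 * (D * b * S)], with value
   [c ^+ 2 / D * b * S]. *)
have : 2 * (c / D) * \sum_(M0 <= i < N) fprob P (E i) <=
   fprob P U + (c / D) ^+ 2 *
     \sum_(M0 <= i < N) \sum_(M0 <= j < N) fprob P (E i `&` E j).
  apply: chung_erdos => // n; rewrite mem_index_iota => /andP[Mn _] x En.
  by exists n => //=; apply: leq_trans Mn; exact: leq_maxr.
have geM0 n : (M0 <= n < N)%N -> (n0 <= n)%N.
  by case/andP => Mn _; apply: leq_trans Mn; exact: leq_maxl.
have lo : c * b * S <= \sum_(M0 <= i < N) fprob P (E i).
  rewrite /S mulr_sumr big_nat_cond [leRHS]big_nat_cond.
  by apply: ler_sum => n; rewrite andbT => /geM0 /Elo.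
have up : \sum_(M0 <= i < N) \sum_(M0 <= j < N) fprob P (E i `&` E j) <= D * b * S.
  have ov i j : (M0 <= i < N)%N -> (M0 <= j < N)%N -> fprob P (E i `&` E j) <=
      C * b * (p i * p j + th ^+ ((i - j) + (j - i)) * (p i + p j)).
    move=> /geM0 ni /geM0 nj; have [ij|ji|<-] := ltngtP i j.
    - have -> : (i - j = 0)%N by apply/eqP; rewrite subn_eq0 ltnW.
      exact: Eov.
    - have -> : (j - i = 0)%N by apply/eqP; rewrite subn_eq0 ltnW.
      by rewrite addn0 setIC (addrC (p i)) (mulrC (p i)); exact: Eov.
    (* On the diagonal the exponent vanishes, and the term [p i + p i] absorbs the first moment. *)
    - rewrite setIid subnn addn0 expr0 mul1r.
      apply: (le_trans (Eup _ ni)); rewrite ler_wpM2l ?mulr_ge0 ?(ltW C0)//.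
      by have := p0 i; have := mulr_ge0 (p0 i) (p0 i); lra.
  apply: (@le_trans _ _ (\sum_(M0 <= i < N) \sum_(M0 <= j < N)
      C * b * (p i * p j + th ^+ ((i - j) + (j - i)) * (p i + p j)))).
    rewrite big_nat_cond [leRHS]big_nat_cond; apply: ler_sum => i; rewrite andbT => Mi.
    rewrite big_nat_cond [leRHS]big_nat_cond; apply: ler_sum => j; rewrite andbT => Mj.
    exact: ov.
  have tail i : \sum_(M0 <= j < N) th ^+ ((i - j) + (j - i)) <= 2 / (1 - th).
    apply: le_trans (sum_expr_dist i N th0 th1).
    have [MN|NM] := leqP M0 N.
      rewrite [leRHS](big_cat_nat _ MN)//= lerDr sumr_ge0// => j _.
      by rewrite exprn_ge0.
    by rewrite big_geq ?(ltnW NM)// sumr_ge0// => j _; rewrite exprn_ge0.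
  have -> : \sum_(M0 <= i < N) \sum_(M0 <= j < N)
      C * b * (p i * p j + th ^+ ((i - j) + (j - i)) * (p i + p j)) =
    C * b * (S * S + 2 * \sum_(M0 <= i < N) p i *
      \sum_(M0 <= j < N) th ^+ ((i - j) + (j - i))).
    rewrite mulr_suml.
    under eq_bigr do rewrite -mulr_sumr.
    rewrite -mulr_sumr; congr (_ * _).
    under eq_bigr do rewrite big_split/=.
    rewrite big_split/=; congr (_ + _).
      by apply: eq_bigr => i _; rewrite mulr_sumr.
    under eq_bigr do under eq_bigr do rewrite mulrDr.
    under eq_bigr do rewrite big_split/=.
    rewrite big_split/= mulr_natl mulr2n; congr (_ + _).
      apply: eq_bigr => i _; rewrite mulr_sumr; apply: eq_bigr => j _.
      by rewrite mulrC.
    rewrite exchange_big/=; apply: eq_bigr => i _; rewrite mulr_sumr.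
    by apply: eq_bigr => j _; rewrite mulrC addnC.
  have S0 : 0 <= S by apply: sumr_ge0 => i _.
  have h : \sum_(M0 <= i < N) p i *
      \sum_(M0 <= j < N) th ^+ ((i - j) + (j - i)) <= S * (2 / (1 - th)).
    by rewrite mulr_suml; apply: ler_sum => i _; rewrite ler_wpM2l.
  have S2 : S * S <= 2 * S by rewrite ler_wpM2r.
  rewrite /D (_ : C * _ * b * S = C * b * (2 * S + 2 * (S * (2 / (1 - th))))).
    by rewrite ler_wpM2l ?mulr_ge0 ?(ltW C0)// lerD// ler_wpM2l.
  by field; rewrite gt_eqF.
move=> chung.
have h1 : 2 * (c / D) * (c * b * S) <=
    2 * (c / D) * \sum_(M0 <= i < N) fprob P (E i).
  by rewrite ler_wpM2l// mulr_ge0// divr_ge0 ?ltW.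
have h2 : (c / D) ^+ 2 *
     \sum_(M0 <= i < N) \sum_(M0 <= j < N) fprob P (E i `&` E j) <=
   (c / D) ^+ 2 * (D * b * S) by rewrite ler_wpM2l// sqr_ge0.
have h3 : 2 * (c / D) * (c * b * S) - (c / D) ^+ 2 * (D * b * S) = c ^+ 2 / D * b * S.
  by field; rewrite gt_eqF.
have h4 : c ^+ 2 / D * b <= c ^+ 2 / D * b * S.
  by rewrite ler_peMr// mulr_ge0// divr_ge0 ?sqr_ge0// ltW.
lra.
Qed.

Lemma ler_powRl (R : realType) (x y s : R) : 0 <= s -> 0 <= x -> x <= y ->
  x `^ s <= y `^ s.
Proof.
by move=> s0 x0 xy; apply: ge0_ler_powR => //; rewrite nnegrE// (le_trans x0).
Qed.

(* If some base [a i] with a positive exponent is below [t], that single factor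
   already supplies [t `^ sigma]; otherwise every [a i + t] is at most
   [2 * a i]. *)
Lemma prod_powRD_le (R : realType) (I : finType) (a s : I -> R) (t sigma : R) :
  (forall i, 0 <= a i <= 1) -> 0 <= t <= 1 ->
  (forall i, 0 <= s i) -> 0 <= sigma -> (forall i, s i = 0 \/ sigma <= s i) ->
  \prod_i (a i + t) `^ s i <=
    \prod_i 2 `^ s i * (\prod_i a i `^ s i + t `^ sigma).
Proof.
move=> a01 /andP[t0 t1] s0 sg0 ssg.
have max01 i : 0 <= Num.max (a i) t <= 1.
  by have /andP[a0 a1] := a01 i; rewrite le_max a0/= ge_max a1.
apply: (@le_trans _ _ (\prod_i (2 `^ s i * Num.max (a i) t `^ s i))).
  apply: ler_prod => i _; have /andP[a0 a1] := a01 i.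
  rewrite powR_ge0/= -powRM//; last by case/andP: (max01 i).
  apply: ler_powRl => //; first by rewrite addr_ge0.
  by rewrite mulr_natl mulr2n lerD// le_max lexx ?orbT.
rewrite big_split/=; apply: ler_wpM2l.
  by apply: prodr_ge0 => i _; exact: powR_ge0.
have [[i [si ai]]|/forallNP h] := pselect (exists i, s i <> 0 /\ a i < t).
  apply: (@le_trans _ _ (t `^ sigma)); last first.
    by rewrite lerDr prodr_ge0// => j _; exact: powR_ge0.
  rewrite (bigD1 i)//= (max_r (ltW ai)).
  have [//|sgi] := ssg i.
  apply: (@le_trans _ _ (t `^ s i * 1)).
    rewrite ler_wpM2l ?powR_ge0// prodr_ile1// => j _; rewrite powR_ge0/=.
    have /andP[m0 m1] := max01 j.
    by have := ler_powRl (s0 j) m0 m1; rewrite powR1.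
  rewrite mulr1; move: t0; rewrite le_eqVlt => /orP[/eqP t0|t0].
    by move: ai; rewrite -t0 => /lt_geF; case/andP: (a01 i) => ->.
  by apply: ger_powR => //; rewrite t0.
apply: (@le_trans _ _ (\prod_i a i `^ s i)); last by rewrite lerDl powR_ge0.
apply: ler_prod => i _; rewrite powR_ge0/=.
have [->|/eqP si] := eqVneq (s i) 0; first by rewrite !powRr0.
have /not_andP[//|/negP] := h i; rewrite -leNgt => tai.
by rewrite max_l.
Qed.

(** * Products of Ahlfors regular spaces *)

Section metric.
Context {R : realType} {X : metricType R}.
Implicit Types (x y : X) (r s : R) (A : set X).

Lemma mball_subset x y r s t : ball x r y -> r + s <= t -> ball y s `<=` ball x t.
Proof.
move=> xy rst z yz; apply: (@le_ball _ _ x (r + s)) => //.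
exact: ball_triangle xy yz.
Qed.

Lemma mball_center x r : 0 < r -> ball x r x.
Proof. by move=> r0; rewrite ballEmdist/= mdistxx. Qed.

Lemma mball_inner x y r : ball x r y -> exists2 s, 0 < s & ball y s `<=` ball x r.
Proof.
move=> xy; exists (r - mdist x y).
  by move: xy; rewrite ballEmdist/= subr_gt0.
move=> z; rewrite !ballEmdist/= => yz.
by apply: le_lt_trans (metric_triangle x y z) _; lra.
Qed.

Lemma mball_open x r : open (ball x r).
Proof.
rewrite openE => y /mball_inner[s s0 sxr]; apply/nbhs_ballP.
by exists s.
Qed.

Lemma nbhd_open A r : open (nbhd A r).
Proof. by apply: bigcup_open => x _; exact: mball_open. Qed.

Lemma nbhd_le A r s : r <= s -> nbhd A r `<=` nbhd A s.
Proof. by move=> rs y [x Ax xy]; exists x => //; exact: le_ball xy. Qed.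

Lemma nbhd_ball A x y r s t : nbhd A r x -> ball x s y -> r + s <= t -> nbhd A t y.
Proof.
by move=> [a Aa ax] xy rst; exists a => //; exact: mball_subset ax rst _ xy.
Qed.

End metric.

Lemma open_borel_measurable (R : realType) (X : pmetricType R) (A : set X) :
  open A -> measurable (A : set (borel X)).
Proof. by move=> oA; exact: (@sub_sigma_algebra _ setT (@open X)). Qed.

Lemma powR_div (R : realType) (x y a : R) : 0 <= x -> 0 < y ->
  (x / y) `^ a = x `^ a / y `^ a.
Proof.
move=> x0 y0; have ya : y `^ a != 0 by rewrite gt_eqF// powR_gt0.
apply: (mulIf ya); rewrite divfK// -powRM ?divr_ge0 ?(ltW y0)//.
by rewrite divfK// gt_eqF.
Qed.

Section product_balls.
Context {R : realType} {d : nat} {X : 'I_d -> pmetricType R}.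
Implicit Types (x y z : forall i, X i) (A B : forall i, set (X i)).

Lemma rectangleI A B :
  rectangle A `&` rectangle B = rectangle (fun i => A i `&` B i).
Proof.
apply/seteqP; split => [x [Ax Bx] i|x ABx]; first by split; [exact: Ax|exact: Bx].
by split => i; case: (ABx i).
Qed.

Lemma rectangle_measurable A : (forall i, open (A i)) ->
  measurable (rectangle A : set (prod_space X)).
Proof.
move=> oA; suff : <<s @measurable_rectangles R d X >> (rectangle A) by [].
apply: (@sub_sigma_algebra _ setT (@measurable_rectangles R d X)).
exists A => //= i; exact: open_borel_measurable.
Qed.

Lemma pball_center x (r : R) : 0 < r -> pball x r x.
Proof. by move=> r0 i; exact: mball_center. Qed.

Lemma pball_sym x y (r : R) : pball x r y -> pball y r x.
Proof. by move=> xy i; apply: ball_sym; exact: xy. Qed.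

Lemma pball_triangle x y z (r s : R) :
  pball x r y -> pball y s z -> pball x (r + s) z.
Proof. by move=> xy yz i; apply: ball_triangle (xy i) (yz i). Qed.

Lemma pball_measurable x (r : R) : measurable (pball x r : set (prod_space X)).
Proof. by apply: rectangle_measurable => i; exact: mball_open. Qed.

Definition prod_ball : prod_space X -> R -> set (prod_space X) := @pball R d X.

(** Finitely many coordinates admit a common radius. *)
Lemma rectangle_ball_open A : (forall i, open (A i)) ->
  ball_open_set prod_ball (rectangle A).
Proof.
move=> oA x Ax.
have : \forall r \near (0 : R)^'+, forall i, ball (x i) r `<=` A i.
  apply: filter_forall => i.
  have : nbhs (x i) (A i) by apply: open_nbhs_nbhs; split.
  move=> /nbhs_ballP[e/= e0 eA]; near=> r.
  by apply: subset_trans eA; apply: le_ball; near: r; exact: nbhs_right_le.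
move=> h; have [r [r0 rA]] : exists r : R, 0 < r /\ forall i, ball (x i) r `<=` A i.
  have [r hr] := @filter_ex _ _ _ _ (filterI (nbhs_right_gt (0:R)) h).
  by exists r.
by exists r => // y xy i; apply: rA; exact: xy.
Unshelve. all: by end_near.
Qed.

Lemma pball_ball_open x (r : R) : ball_open_set prod_ball (pball x r).
Proof. by apply: rectangle_ball_open => i; exact: mball_open. Qed.

End product_balls.

Section product_measure.
Context {R : realType} {d : nat} {X : 'I_d -> pmetricType R}.
Variables (mu_ : forall i, probability (borel (X i)) R)
  (P : probability (prod_space X) R).
Hypothesis P_prod : is_product_measure mu_ P.
Variables (delta : 'I_d -> R) (c r0 : R).
Hypotheses (delta_ge0 : forall i, 0 <= delta i) (c_gt0 : 0 < c) (r0_gt0 : 0 < r0).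
Hypothesis ahlfors : forall i (x : X i) (r : R), 0 < r -> r < r0 ->
  c^-1 * r `^ delta i <= fprob (mu_ i) (ball x r) <= c * r `^ delta i.
Local Notation m := (fprob P).

Lemma fprob_rectangle (A : forall i, set (X i)) : (forall i, open (A i)) ->
  m (rectangle A) = \prod_i fprob (mu_ i) (A i).
Proof.
move=> oA; apply: EFin_inj; rewrite -fprobE; last exact: rectangle_measurable.
rewrite P_prod; last by move=> i; exact: open_borel_measurable.
rewrite -prodEFin; apply: eq_bigr => i _; apply: fprobE.
exact: open_borel_measurable.
Qed.

Lemma fprob_rectangle_le (A : forall i, set (X i)) (b : 'I_d -> R) :
  (forall i, open (A i)) -> (forall i, fprob (mu_ i) (A i) <= b i) ->
  m (rectangle A) <= \prod_i b i.
Proof.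
move=> oA Ab; rewrite fprob_rectangle//; apply: ler_prod => i _.
by rewrite fprob_ge0/= Ab.
Qed.

Lemma fprob_rectangle_ge (A : forall i, set (X i)) (b : 'I_d -> R) :
  (forall i, open (A i)) -> (forall i, 0 <= b i <= fprob (mu_ i) (A i)) ->
  \prod_i b i <= m (rectangle A).
Proof. by move=> oA Ab; rewrite fprob_rectangle//; apply: ler_prod => i _. Qed.

Lemma fprob_box_ge (x : forall i, X i) (r : 'I_d -> R) :
  (forall i, 0 < r i < r0) ->
  \prod_i (c^-1 * r i `^ delta i) <= m (rectangle (fun i => ball (x i) (r i))).
Proof.
move=> hr; apply: fprob_rectangle_ge => i; first exact: mball_open.
have /andP[r_gt0 rr0] := hr i.
rewrite mulr_ge0 ?invr_ge0 ?powR_ge0 ?(ltW c_gt0)//=.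
by case/andP: (ahlfors (x i) r_gt0 rr0).
Qed.

Lemma fprob_pball_pos (r : R) : 0 < r ->
  exists2 eta : R, 0 < eta & forall x : forall i, X i, eta <= m (pball x r).
Proof.
move=> r_gt0; pose s := Num.min r (r0 / 2).
have s0 : 0 < s by rewrite lt_min r_gt0 divr_gt0.
have sr0 : s < r0 by rewrite /s gt_min; apply/orP; right; (have := r0_gt0; lra).
exists (\prod_(i < d) (c^-1 * s `^ delta i)).
  by apply: prodr_gt0 => i _; rewrite mulr_gt0 ?invr_gt0 ?powR_gt0.
move=> x; apply: (@le_trans _ _ (m (pball x s))).
  by apply: (@fprob_box_ge x (fun=> s)) => i; rewrite s0 sr0.
apply: fprob_le; [exact: pball_measurable..|].
by move=> y xy i; apply: le_ball (xy i); rewrite ge_min lexx.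
Qed.

Lemma prod_ball_open_measurable (G : set (prod_space X)) :
  ball_open_set prod_ball G -> measurable G.
Proof.
apply: (@ball_open_set_measurable _ _ _ P prod_ball).
- exact: pball_center.
- exact: pball_sym.
- exact: pball_triangle.
- exact: pball_measurable.
- exact: fprob_pball_pos.
Qed.

(** The ratio of the upper Ahlfors bound at radius [r] to the lower one at [r / 2], multiplied over
    the coordinates. *)
Definition doubling_constant := \prod_(i < d) (c ^+ 2 * 2 `^ delta i).

Lemma doubling_constant_gt0 : 0 < doubling_constant.
Proof. by apply: prodr_gt0 => i _; rewrite mulr_gt0 ?exprn_gt0 ?powR_gt0. Qed.

Lemma fprob_pball_doubling (x : forall i, X i) (r : R) : 0 < r -> r < r0 ->
  m (pball x r) <= doubling_constant * m (pball x (r / 2)).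
Proof.
move=> r_gt0 rr0; have r2 : 0 < r / 2 by rewrite divr_gt0.
have r2r0 : r / 2 < r0 by lra.
have := @fprob_box_ge x (fun=> r / 2) _; rewrite r2 r2r0 => /(_ (fun=> isT)) h.
apply: le_trans (ler_wpM2l (ltW doubling_constant_gt0) h).
rewrite /doubling_constant -big_split/=; apply: fprob_rectangle_le => i.
  exact: mball_open.
have /andP[_ /le_trans] := ahlfors (x i) r_gt0 rr0; apply.
rewrite powR_div ?(ltW r_gt0)// le_eqVlt; apply/orP; left; apply/eqP.
by field; rewrite !gt_eqF// powR_gt0.
Qed.

(** * Stages of the construction: boxes and pieces around resonant points *)

Section layers.
Context {J : Type}.
Variables (Res : J -> forall i, set (X i)) (kappa : 'I_d -> R).
Arguments Res : clear implicits.
Hypothesis kappa01 : forall i, 0 <= kappa i < 1.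
Local Notation s i := (delta i * (1 - kappa i)).
Local Notation dk i := (delta i * kappa i).
Hypothesis scaling : forall i a (x : X i) (r e : R),
  Res a i x -> r < r0 -> 0 < e -> e < r ->
  c^-1 * (r `^ dk i * e `^ s i) <=
    fprob (mu_ i) (ball x r `&` nbhd (Res a i) e) <= c * (r `^ dk i * e `^ s i).

Lemma delta_1Bkappa_ge0 i : 0 <= s i.
Proof. by rewrite mulr_ge0// subr_ge0 ltW//; case/andP: (kappa01 i). Qed.

Lemma delta_kappa_ge0 i : 0 <= dk i.
Proof. by rewrite mulr_ge0//; case/andP: (kappa01 i). Qed.

(** Splits the Ahlfors exponent into the two exponents of the scaling property, so that volumes of
    boxes and of pieces become comparable. *)
Lemma powR_delta i (x : R) : 0 < x -> x `^ delta i = x `^ dk i * x `^ s i.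
Proof.
move=> x0; rewrite -powRD; last by rewrite (gt_eqF x0) implybT.
by congr (_ `^ _); ring.
Qed.

Definition box (rh : 'I_d -> R) (z : forall i, X i) :=
  rectangle (fun i => ball (z i) (2 * rh i)).

(** With the radius [2 * rh i] the scaling property, which needs a strict inequality, applies even
    when [ps i = rh i]. *)
Definition piece (rh ps : 'I_d -> R) (a : J) (z : forall i, X i) :=
  rectangle (fun i => ball (z i) (2 * rh i) `&` nbhd (Res a i) (ps i)).

(* The boxes of one stage of the construction, together with a resonant point
   at the centre of each of them. *)
Record layer (x0 : forall i, X i) (r : R) (W : set J) (rh ps : 'I_d -> R) := Layer {
  layer_size : nat;
  layer_center : 'I_layer_size -> forall i, X i;
  layer_index : 'I_layer_size -> J;
  layer_window : forall k, W (layer_index k);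
  layer_Res : forall k i, Res (layer_index k) i (layer_center k i);
  layer_disjoint : forall k k', box rh (layer_center k) `&`
    box rh (layer_center k') !=set0 -> k = k';
  layer_box : forall k, box rh (layer_center k) `<=` pball x0 r
}.

Arguments layer_center {x0 r W rh ps} _ _.
Arguments layer_index {x0 r W rh ps} _ _.

Definition layer_set x0 r W rh ps (L : layer x0 r W rh ps) : set (prod_space X) :=
  \bigcup_(k in [set` predT : pred 'I_(layer_size L)])
    piece rh ps (layer_index L k) (layer_center L k).

Lemma box_measurable rh z : measurable (box rh z : set (prod_space X)).
Proof. by apply: rectangle_measurable => i; exact: mball_open. Qed.

Lemma piece_open rh ps a (z : forall i, X i) i :
  open (ball (z i) (2 * rh i) `&` nbhd (Res a i) (ps i)).
Proof. by apply: openI; [exact: mball_open|exact: nbhd_open]. Qed.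

Lemma piece_measurable rh ps a z :
  measurable (piece rh ps a z : set (prod_space X)).
Proof. by apply: rectangle_measurable => i; exact: piece_open. Qed.

Lemma piece_box rh ps a z : piece rh ps a z `<=` box rh z.
Proof. by move=> x Ax i; case: (Ax i). Qed.

Lemma layer_set_measurable x0 r W rh ps (L : layer x0 r W rh ps) :
  measurable (layer_set L).
Proof. by apply: fin_bigcup_measurable => // k _; exact: piece_measurable. Qed.

(** A Vitali covering argument: a point of the ubiquity set is close to a resonant point whose box
    meets a selected one, so the selected boxes cover once enlarged. The resulting inequality is a
    lower bound for the number of boxes. *)
Lemma layer_exists x0 (r cu : R) W rh ps :
  (forall i, 0 < rh i) -> (forall i, 7 * rh i < r0) ->
  (forall i, 6 * rh i <= r) ->
  cu * m (pball x0 (r / 2)) <= m (pball x0 (r / 2) `&`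
    \bigcup_(a in W) rectangle (fun i => nbhd (Res a i) (rh i))) ->
  exists L : layer x0 r W rh ps, cu * m (pball x0 (r / 2)) <=
    (layer_size L)%:R * \prod_i (c * (5 * rh i) `^ delta i).
Proof.
move=> rh0 rhr0 rhr ubiq.
(* Boxes centred in [G] reach at most [r / 2 + 3 * rh i] from [x0], hence stay in the ball because
   [6 * rh i <= r]. *)
pose G := [set w | (exists2 a, W a & forall i, Res a i (w i)) /\
  forall i, ball (x0 i) (r / 2 + rh i) (w i)].
have [||N [z [Gz dz zmax]]] := @maximal_disjoint _ _ _ P (box rh) G
    (\prod_i (c^-1 * (2 * rh i) `^ delta i)).
- apply: prodr_gt0 => i _.
  by rewrite mulr_gt0 ?invr_gt0 ?powR_gt0// mulr_gt0.
- move=> x _; split; first exact: box_measurable.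
  apply: fprob_box_ge => i; have := rh0 i; have := rhr0 i; lra.
have /choice[al alP] : forall k, exists a, W a /\ forall i, Res a i (z k i).
  by move=> k; case: (Gz k) => -[a Wa Ra] _; exists a.
have zr k : box rh (z k) `<=` pball x0 r.
  move=> y zy i; have [_ /(_ i) xz] := Gz k.
  apply: mball_subset xz _ _ (zy i).
  have := rhr i; lra.
exists (@Layer x0 r W rh ps N z al (fun k => (alP k).1) (fun k => (alP k).2) dz zr).
apply: (le_trans ubiq) => /=.
apply: (@le_trans _ _ (\sum_(k < N) m (rectangle (fun i => ball (z k i) (5 * rh i))))).
  apply: fprob_subadditive.
  - apply: measurableI; first exact: pball_measurable.
    apply: prod_ball_open_measurable.
    apply: ball_open_set_bigcup => a; apply: rectangle_ball_open => i.
    exact: nbhd_open.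
  - by move=> k; apply: rectangle_measurable => i; exact: mball_open.
  - move=> x [x0x [a Wa /= Ux]].
    have [w wP] : exists w : forall i, X i,
        forall i, Res a i (w i) /\ ball (w i) (rh i) (x i).
      have h i : {w | Res a i w /\ ball w (rh i) (x i)}.
        by apply: cid; have [w Rw wx] := Ux i; exists w.
      by exists (fun i => projT1 (h i)) => i; case: (h i).
    have Gw : G w.
      split; first by exists a => // i; case: (wP i).
      move=> i; have [_ /ball_sym wx] := wP i.
      exact: ball_triangle (x0x i) wx.
    have [k [y [wy zy]]] := zmax w Gw.
    exists k => // i; have [_ wx] := wP i.
    (* [5 = 2 + 2 + 1]: across the two meeting boxes, then from [w] to [x]. *)
    have h := ball_triangle (zy i) (ball_sym (wy i)).
    by apply: le_ball (ball_triangle h wx); have := rh0 i; lra.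
apply: (@le_trans _ _ (\sum_(k < N) \prod_i (c * (5 * rh i) `^ delta i))).
  apply: ler_sum => k _; apply: fprob_rectangle_le => i; first exact: mball_open.
  have := rh0 i; have := rhr0 i => h1 h2.
  have /andP[] := @ahlfors i (z k i) (5 * rh i) ltac:(lra) ltac:(lra) => //.
by rewrite sumr_const card_ord mulr_natl.
Qed.

Section one_layer.
Variables (x0 : forall i, X i) (r : R) (W : set J) (rh ps : 'I_d -> R).
Hypotheses (ps0 : forall i, 0 < ps i) (psrh : forall i, ps i <= rh i)
  (rhr0 : forall i, 7 * rh i < r0).
Variable L : layer x0 r W rh ps.

Let rh0 i : 0 < rh i. Proof. exact: lt_le_trans (psrh i). Qed.

Lemma layer_set_subset : layer_set L `<=` pball x0 r.
Proof. by move=> x [k _ /piece_box]; exact: layer_box. Qed.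

Lemma layer_size_le :
  (layer_size L)%:R * \prod_i (c^-1 * (2 * rh i) `^ delta i) <= m (pball x0 r).
Proof.
apply: (@le_trans _ _ (\sum_(k < layer_size L) m (box rh (layer_center L k)))).
  rewrite mulr_natl -[in leLHS](card_ord (layer_size L)) -sumr_const.
  apply: ler_sum => k _; apply: fprob_box_ge => i.
  have := rh0 i; have := rhr0 i; lra.
rewrite -fprob_bigcup.
- apply: fprob_le.
  + by apply: fin_bigcup_measurable => // k _; exact: box_measurable.
  + exact: pball_measurable.
  + by move=> x [k _]; exact: layer_box.
- by move=> k _; exact: box_measurable.
- by move=> k k' _ _; exact: layer_disjoint.
Qed.

Lemma fprob_layer_set : m (layer_set L) =
  \sum_k m (piece rh ps (layer_index L k) (layer_center L k)).
Proof.
apply: fprob_bigcup => [k _|k k' _ _ [x [kx k'x]]]; first exact: piece_measurable.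
by apply: (@layer_disjoint _ _ _ _ _ L); exists x; split; exact: piece_box.
Qed.

Lemma fprob_piece k :
  \prod_i (c^-1 * ((2 * rh i) `^ dk i * ps i `^ s i)) <=
    m (piece rh ps (layer_index L k) (layer_center L k)) <=
  \prod_i (c * ((2 * rh i) `^ dk i * ps i `^ s i)).
Proof.
have sc i : c^-1 * ((2 * rh i) `^ dk i * ps i `^ s i) <=
    fprob (mu_ i) (ball (layer_center L k i) (2 * rh i) `&`
      nbhd (Res (layer_index L k) i) (ps i)) <=
    c * ((2 * rh i) `^ dk i * ps i `^ s i).
  have := rh0 i; have := rhr0 i; have := psrh i => h1 h2 h3.
  by apply: scaling; [exact: layer_Res|lra|exact: ps0|lra].
apply/andP; split.
  apply: fprob_rectangle_ge => i; first exact: piece_open.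
  have /andP[-> _] := sc i.
  by rewrite mulr_ge0 ?invr_ge0 ?mulr_ge0 ?powR_ge0// ltW.
apply: fprob_rectangle_le => i; first exact: piece_open.
by case/andP: (sc i).
Qed.

(** The packing bound [layer_size_le] times the largest possible piece; in coordinate i the bound
    for a piece is at most c^2 (ps_i/rh_i)^(s_i) times the lower bound for its box. *)
Lemma fprob_layer_set_le : m (layer_set L) <=
  c ^+ 2 ^+ d * m (pball x0 r) * \prod_i (ps i / rh i) `^ s i.
Proof.
apply: (@le_trans _ _ ((layer_size L)%:R *
    \prod_i (c * ((2 * rh i) `^ dk i * ps i `^ s i)))).
  rewrite fprob_layer_set mulr_natl -[in leRHS](card_ord (layer_size L)) -sumr_const.
  by apply: ler_sum => k _; case/andP: (fprob_piece k).
apply: (@le_trans _ _ ((layer_size L)%:R *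
    \prod_i (c^-1 * (2 * rh i) `^ delta i) *
    \prod_i (c ^+ 2 * (ps i / rh i) `^ s i))).
  rewrite -mulrA ler_wpM2l// -big_split/=; apply: ler_prod => i _.
  apply/andP; split; first by rewrite mulr_ge0 ?mulr_ge0 ?powR_ge0// ltW.
  rewrite powR_div ?(ltW (ps0 _))// powR_delta ?mulr_gt0//.
  rewrite [in leRHS](@powRM _ 2 (rh i) (s i)) ?(ltW (rh0 _))//.
  rewrite [leRHS](_ : _ = c * ((2 * rh i) `^ dk i * ps i `^ s i) * 2 `^ s i).
    rewrite ler_peMr ?mulr_ge0 ?powR_ge0 ?(ltW c_gt0)//.
    by rewrite -[leLHS](powRr0 2) ler_powR ?ler1n// delta_1Bkappa_ge0.
  by field; rewrite !gt_eqF// powR_gt0.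
have -> : \prod_i (c ^+ 2 * (ps i / rh i) `^ s i) =
    c ^+ 2 ^+ d * \prod_i (ps i / rh i) `^ s i.
  by rewrite big_split/= prodr_const card_ord.
rewrite mulrA.
rewrite ler_wpM2r//; first by rewrite prodr_ge0// => i _; exact: powR_ge0.
rewrite [leRHS]mulrC ler_wpM2r//; last exact: layer_size_le.
by rewrite !exprn_ge0// ltW.
Qed.

(** The last hypothesis is the covering count supplied by [layer_exists]; doubling passes from
    radius [r / 2] to [r], and the count is multiplied by the smallest possible piece. *)
Lemma fprob_layer_set_ge (cu : R) : 0 < cu ->
  r < r0 -> 0 < r ->
  cu * m (pball x0 (r / 2)) <=
    (layer_size L)%:R * \prod_i (c * (5 * rh i) `^ delta i) ->
  cu / doubling_constant / \prod_(i < d) (c ^+ 2 * 5 `^ delta i) *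
    m (pball x0 r) * \prod_i (ps i / rh i) `^ s i <= m (layer_set L).
Proof.
move=> cu0 rr0 r_gt0 hL.
set K := \prod_(i < d) (c ^+ 2 * _).
have K0 : 0 < K.
  by apply: prodr_gt0 => i _; rewrite mulr_gt0 ?exprn_gt0 ?powR_gt0.
have h1 : cu / doubling_constant * m (pball x0 r) <=
    (layer_size L)%:R * \prod_i (c * (5 * rh i) `^ delta i).
  apply: le_trans hL; rewrite -mulrA ler_wpM2l ?(ltW cu0)//.
  rewrite ler_pdivrMl ?doubling_constant_gt0//.
  exact: fprob_pball_doubling.
apply: (@le_trans _ _ ((layer_size L)%:R *
    \prod_i (c^-1 * ((2 * rh i) `^ dk i * ps i `^ s i)))); last first.
  rewrite fprob_layer_set mulr_natl -[in leLHS](card_ord (layer_size L)) -sumr_const.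
  by apply: ler_sum => k _; case/andP: (fprob_piece k).
rewrite [leLHS](_ : _ = cu / doubling_constant * m (pball x0 r) *
    (K^-1 * \prod_i (ps i / rh i) `^ s i)); last first.
  by field; rewrite !gt_eqF// doubling_constant_gt0.
have pK : 0 <= K^-1 * \prod_i (ps i / rh i) `^ s i.
  by rewrite mulr_ge0 ?invr_ge0 ?(ltW K0)// prodr_ge0// => i _; exact: powR_ge0.
apply: (le_trans (ler_wpM2r pK h1)).
rewrite -mulrA ler_wpM2l//.
rewrite /K -prodfV -!big_split/=; apply: ler_prod => i _.
have gt0 (x a : R) : 0 < x -> x `^ a != 0 by move=> x0'; rewrite gt_eqF// powR_gt0.
apply/andP; split.
  rewrite !mulr_ge0 ?invr_ge0 ?mulr_ge0 ?powR_ge0 ?exprn_ge0 ?(ltW c_gt0)//.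
rewrite (powRM _ _ (ltW (rh0 i)))// (powRM _ _ (ltW (rh0 i)))//.
rewrite powR_div ?(ltW (ps0 i))// (powR_delta _ (rh0 i)).
rewrite [leLHS](_ : _ = c^-1 * (rh i `^ dk i * ps i `^ s i)).
  rewrite ler_wpM2l ?invr_ge0 ?(ltW c_gt0)// ler_wpM2r ?powR_ge0//.
  rewrite ler_peMl ?powR_ge0//.
  by rewrite -[leLHS](powRr0 2) ler_powR ?ler1n// delta_kappa_ge0.
by field; rewrite !gt0 ?gt_eqF// rh0.
Qed.

End one_layer.

(** * Overlap of an earlier and a later stage *)

Section two_layers.
Variables (x0 : forall i, X i) (r : R) (W W' : set J) (rh ps rh' ps' : 'I_d -> R).
Hypotheses (ps0 : forall i, 0 < ps i) (psrh : forall i, ps i <= rh i)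
  (rhr0 : forall i, 7 * rh i < r0).
Hypotheses (ps0' : forall i, 0 < ps' i) (psrh' : forall i, ps' i <= rh' i)
  (rhr0' : forall i, 7 * rh' i < r0).
Hypothesis ps'rh : forall i, ps' i <= rh i.
Variables (L : layer x0 r W rh ps) (L' : layer x0 r W' rh' ps').

Let rh0 i : 0 < rh i. Proof. exact: lt_le_trans (psrh i). Qed.
Let rh0' i : 0 < rh' i. Proof. exact: lt_le_trans (psrh' i). Qed.

(* [rh'] is the later stage, but when only [psi] is regular its boxes may be
   wider than those of [rh].  In such a coordinate the trace of a later piece on
   an earlier one is estimated in a ball of radius [5 * rh i] about a point of
   its own resonant set, so that both bounds involve the smaller radius. *)
Let overlap_bound i := if rh' i <= rh i then c * ((2 * rh' i) `^ dk i * ps' i `^ s i)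
  else c * ((5 * rh i) `^ dk i * ps' i `^ s i).

Let shadow_bound i := if rh' i <= rh i
  then c * ((6 * rh i) `^ dk i * (ps i + 4 * rh' i) `^ s i)
  else c * (6 * rh' i) `^ delta i.

(* Contains every later box whose piece meets the piece of [rh] at [z]. *)
Let shadow a z i := if rh' i <= rh i
  then ball (z i) (6 * rh i) `&` nbhd (Res a i) (ps i + 4 * rh' i)
  else ball (z i) (6 * rh' i).

Arguments shadow : clear implicits.

Lemma fprob_pieceI a (z : forall i, X i) a' (z' : forall i, X i) :
  (forall i, Res a' i (z' i)) ->
  piece rh ps a z `&` piece rh' ps' a' z' !=set0 ->
  m (piece rh ps a z `&` piece rh' ps' a' z') <= \prod_i overlap_bound i.
Proof.
move=> Rz' [w [wz wz']]; rewrite rectangleI; apply: fprob_rectangle_le => i.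
  by apply: openI; exact: piece_open.
have [wzi _] := wz i; have [wzi' [v Rv vw]] := wz' i.
have h1 := psrh' i; have h2 := rhr0' i; have h3 := rh0 i; have h4 := rhr0 i.
have h5 := ps'rh i; have h6 := rh0' i.
rewrite /overlap_bound; case: ifPn => hrh.
  have /andP[_] := @scaling i a' (z' i) (2 * rh' i) (ps' i) (Rz' i) ltac:(lra)
    (ps0' i) ltac:(lra).
  apply: le_trans; apply: fprob_le; [| |by move=> y []].
    by apply: open_borel_measurable; apply: openI; exact: piece_open.
  by apply: open_borel_measurable; exact: piece_open.
(* Points of the overlap are within [2 * rh i + 2 * rh i] of [w], and [v] is within [ps' i <= rh i]
   of it; hence the radius [5 * rh i]. *)
have /andP[_] := @scaling i a' v (5 * rh i) (ps' i) Rv ltac:(lra)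
  (ps0' i) ltac:(lra).
apply: le_trans; apply: fprob_le.
- by apply: open_borel_measurable; apply: openI; exact: piece_open.
- by apply: open_borel_measurable; apply: openI; [exact: mball_open|exact: nbhd_open].
- move=> y [[yz _] [_ yR]]; split => //.
  have vz := ball_triangle vw (ball_sym wzi).
  apply: mball_subset vz _ _ yz; lra.
Qed.

(** Through a common point of the pieces, each point of the later box is within
    [2 * rh i + 4 * rh' i] of [z i], at most six times the larger radius, and within
    [ps i + 4 * rh' i] of the resonant set. *)
Lemma box_shadow a (z : forall i, X i) a' (z' : forall i, X i) :
  piece rh ps a z `&` piece rh' ps' a' z' !=set0 ->
  box rh' z' `<=` rectangle (shadow a z).
Proof.
move=> [w [wz wz']] y yz' i.
have [wzi wR] := wz i; have [wzi' _] := wz' i; have yz := yz' i.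
have wy := ball_triangle (ball_sym wzi') yz.
have zy := ball_triangle wzi wy.
have h3 := rh0 i; have h6 := rh0' i.
rewrite /shadow; case: ifPn => hrh.
  split; first by apply: le_ball zy; lra.
  by apply: nbhd_ball wR wy _; lra.
by apply: le_ball zy; move: hrh; rewrite -ltNge; lra.
Qed.

Lemma shadow_open a z i : open (shadow a z i).
Proof.
rewrite /shadow; case: ifP => _; last exact: mball_open.
by apply: openI; [exact: mball_open|exact: nbhd_open].
Qed.

Lemma fprob_shadow a z : (forall i, Res a i (z i)) ->
  m (rectangle (shadow a z)) <= \prod_i shadow_bound i.
Proof.
move=> Rz; apply: fprob_rectangle_le => i; first exact: shadow_open.
have h1 := psrh i; have h2 := rhr0' i; have h3 := rh0 i; have h4 := rhr0 i.
have h5 := ps0 i; have h6 := rh0' i.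
rewrite /shadow /shadow_bound; case: ifPn => hrh.
  by have /andP[] := @scaling i a (z i) (6 * rh i) (ps i + 4 * rh' i) (Rz i)
    ltac:(lra) ltac:(lra) ltac:(lra).
by have /andP[] := @ahlfors i (z i) (6 * rh' i) ltac:(lra) ltac:(lra).
Qed.

(** Overlap times shadow, relative to the volume bounds of a later and an earlier box; the powers of
    common radii cancel. If [rh' i <= rh i] there remains (ps_i ps'_i/(4 rh_i rh'_i) +
    ps'_i/rh_i)^(s_i), otherwise (ps'_i/(2 rh_i))^(s_i), and the right side dominates both. The 3 is
    [6 / 2] and also bounds [5 / 2]. *)
Lemma overlap_coordinate i :
  overlap_bound i * shadow_bound i /
    ((c^-1 * (2 * rh' i) `^ delta i) * (c^-1 * (2 * rh i) `^ delta i)) <=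
  c ^+ 4 * 3 `^ dk i * 3 `^ delta i *
    (ps i / rh i * (ps' i / rh' i) + ps' i / rh i) `^ s i.
Proof.
have h1 := rh0 i; have h2 := rh0' i; have h3 := ps0 i; have h4 := ps0' i.
have c0 := c_gt0.
have gt0 (x a : R) : 0 < x -> x `^ a != 0 by move=> x0'; rewrite gt_eqF// powR_gt0.
set Y := _ + ps' i / rh i.
have one3 : 1 <= 3 `^ delta i.
  by rewrite -[leLHS](powRr0 3) ler_powR// ler1n.
have Y0 : 0 <= Y by rewrite addr_ge0 ?mulr_ge0 ?invr_ge0// ltW.
rewrite (powR_delta _ (_ : 0 < 2 * rh i)) ?mulr_gt0//.
rewrite /overlap_bound /shadow_bound; case: ifPn => hrh.
  rewrite (powR_delta _ (_ : 0 < 2 * rh' i)) ?mulr_gt0//.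
  apply: (@le_trans _ _ (c ^+ 4 * 3 `^ dk i *
      (ps' i * (ps i + 4 * rh' i) / (2 * rh' i * (2 * rh i))) `^ s i)).
    rewrite [in leRHS]powR_div; [|nra|nra].
    rewrite (powRM (s i) (ltW h4)); last lra.
    rewrite (@powRM _ (2 * rh' i) (2 * rh i)); [|lra|lra].
    rewrite (_ : 6 * rh i = 3 * (2 * rh i)); last by ring.
    rewrite (@powRM _ 3 (2 * rh i)); [|lra|lra].
    rewrite le_eqVlt; apply/orP; left; apply/eqP; field.
    by rewrite !gt0 ?mulr_gt0// gt_eqF.
  apply: (@le_trans _ _ (c ^+ 4 * 3 `^ dk i * Y `^ s i)).
    rewrite ler_wpM2l ?mulr_ge0 ?exprn_ge0 ?powR_ge0 ?(ltW c_gt0)//.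
    apply: ler_powRl; first exact: delta_1Bkappa_ge0.
      by rewrite divr_ge0//; nra.
    rewrite (_ : _ / _ = ps i / rh i * (ps' i / rh' i) / 4 + ps' i / rh i).
      rewrite /Y lerD2r ler_pdivrMr// ler_peMr ?ler1n//.
      by rewrite !mulr_ge0 ?invr_ge0// ltW.
    by field; rewrite !gt_eqF.
  rewrite ler_wpM2r ?powR_ge0// ler_peMr// mulr_ge0 ?exprn_ge0 ?powR_ge0//.
  exact: ltW.
apply: (@le_trans _ _ (c ^+ 4 * (5 / 2) `^ dk i * 3 `^ delta i *
    (ps' i / (2 * rh i)) `^ s i)).
  rewrite [X in _ <= _ * X]powR_div; [|lra|lra].
  rewrite (_ : 6 * rh' i = 3 * (2 * rh' i)); last by ring.
  rewrite (@powRM _ 3 (2 * rh' i)); [|lra|lra].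
  rewrite (_ : 5 * rh i = 5 / 2 * (2 * rh i)); last by field.
  rewrite (@powRM _ (5 / 2) (2 * rh i)); [|lra|lra].
  rewrite le_eqVlt; apply/orP; left; apply/eqP; field.
  by rewrite !gt0 ?mulr_gt0// gt_eqF.
rewrite ler_pM ?powR_ge0 ?mulr_ge0 ?powR_ge0 ?exprn_ge0 ?(ltW c_gt0)//.
  rewrite ler_wpM2r ?powR_ge0// ler_wpM2l ?exprn_ge0 ?(ltW c_gt0)//.
  by apply: ler_powRl; [exact: delta_kappa_ge0|lra|lra].
apply: ler_powRl; first exact: delta_1Bkappa_ge0.
  by rewrite divr_ge0//; lra.
apply: (@le_trans _ _ (ps' i / rh i)).
  rewrite invfM mulrA ler_wpM2r ?invr_ge0 ?(ltW h1)//; lra.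
by rewrite /Y lerDr !mulr_ge0 ?invr_ge0// ltW.
Qed.

(** The later boxes whose pieces meet the given piece are disjoint and lie in its shadow, which
    bounds their number; each contributes at most one overlap bound. *)
Lemma fprob_pieceI_layer k :
  m (piece rh ps (layer_index L k) (layer_center L k) `&` layer_set L') *
    \prod_i (c^-1 * (2 * rh' i) `^ delta i) <=
  \prod_i overlap_bound i * \prod_i shadow_bound i.
Proof.
set A := piece _ _ _ _.
pose A' l := piece rh' ps' (layer_index L' l) (layer_center L' l).
pose K := [pred l | `[<A `&` A' l !=set0>]].
have ob0 : 0 <= \prod_i overlap_bound i.
  apply: prodr_ge0 => i _; rewrite /overlap_bound; case: ifP => _.
    by rewrite !mulr_ge0 ?powR_ge0 ?(ltW c_gt0).
  by rewrite !mulr_ge0 ?powR_ge0 ?(ltW c_gt0).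
have box0 : 0 <= \prod_i (c^-1 * (2 * rh' i) `^ delta i).
  by apply: prodr_ge0 => i _; rewrite mulr_ge0 ?invr_ge0 ?powR_ge0 ?(ltW c_gt0).
have cardK : #|K|%:R * \prod_i (c^-1 * (2 * rh' i) `^ delta i) <=
    \prod_i shadow_bound i.
  apply: (le_trans _ (fprob_shadow (@layer_Res _ _ _ _ _ L k))).
  apply: (@le_trans _ _ (\sum_(l | K l) m (box rh' (layer_center L' l)))).
    rewrite mulr_natl -sumr_const; apply: ler_sum => l _.
    by apply: fprob_box_ge => i; have := rh0' i; have := rhr0' i; lra.
  rewrite -fprob_bigcup.
  - apply: fprob_le.
    + by apply: fin_bigcup_measurable => // l _; exact: box_measurable.
    + by apply: rectangle_measurable => i; exact: shadow_open.
    + move=> y [l /= /asboolP Kl]; exact: box_shadow Kl _.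
  - by move=> l _; exact: box_measurable.
  - by move=> l l' _ _; exact: layer_disjoint.
have AE : m (A `&` layer_set L') <= #|K|%:R * \prod_i overlap_bound i.
  apply: (@le_trans _ _ (\sum_(l | K l) m (A `&` A' l))).
    apply: fprob_subadditive.
    - by apply: measurableI; [exact: piece_measurable|exact: layer_set_measurable].
    - by move=> l; apply: measurableI; exact: piece_measurable.
    - move=> x [Ax [l _ A'x]]; exists l => //=.
      by apply/asboolP; exists x.
  rewrite mulr_natl -sumr_const; apply: ler_sum => l /asboolP Kl.
  by apply: fprob_pieceI Kl => i; exact: layer_Res.
apply: (le_trans (ler_wpM2r box0 AE)).
by rewrite mulrAC mulrC ler_wpM2l.
Qed.

Lemma fprob_layer_setI :
  m (layer_set L `&` layer_set L') <=
  \prod_i (c ^+ 4 * 3 `^ dk i * 3 `^ delta i) * m (pball x0 r) *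
  \prod_i (ps i / rh i * (ps' i / rh' i) + ps' i / rh i) `^ s i.
Proof.
set B' := \prod_i (c^-1 * (2 * rh' i) `^ delta i).
set B := \prod_i (c^-1 * (2 * rh i) `^ delta i).
have bgt0 (q : 'I_d -> R) : (forall i, 0 < q i) ->
    0 < \prod_i (c^-1 * (2 * q i) `^ delta i).
  move=> q0; apply: prodr_gt0 => i _.
  by rewrite mulr_gt0 ?invr_gt0 ?powR_gt0// mulr_gt0.
have B0 : 0 < B by exact: bgt0.
have B'0 : 0 < B' by exact: bgt0.
set Q := \prod_i overlap_bound i * \prod_i shadow_bound i.
have h : m (layer_set L `&` layer_set L') <= (layer_size L)%:R * (Q / B').
  apply: (@le_trans _ _ (\sum_(k < layer_size L)
      m (piece rh ps (layer_index L k) (layer_center L k) `&` layer_set L'))).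
    apply: fprob_subadditive.
    - by apply: measurableI; exact: layer_set_measurable.
    - by move=> k; apply: measurableI; [exact: piece_measurable|exact: layer_set_measurable].
    - by move=> x [[k _ Ax] E'x]; exists k.
  rewrite mulr_natl -[in leRHS](card_ord (layer_size L)) -sumr_const.
  by apply: ler_sum => k _; rewrite ler_pdivlMr//; exact: fprob_pieceI_layer.
apply: (le_trans h).
have N : (layer_size L)%:R <= m (pball x0 r) / B.
  by rewrite ler_pdivlMr//; exact: layer_size_le.
have Q0 : 0 <= Q.
  apply: mulr_ge0; apply: prodr_ge0 => i _.
    rewrite /overlap_bound; case: ifP => _;
      by rewrite !mulr_ge0 ?powR_ge0 ?(ltW c_gt0).
  rewrite /shadow_bound; case: ifP => _;
    by rewrite !mulr_ge0 ?powR_ge0 ?(ltW c_gt0).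
apply: (le_trans (ler_wpM2r (divr_ge0 Q0 (ltW B'0)) N)).
rewrite [leLHS](_ : _ = m (pball x0 r) * (Q / (B' * B))); last first.
  by field; rewrite !gt_eqF.
rewrite [leRHS](_ : _ = m (pball x0 r) *
   \prod_i (c ^+ 4 * 3 `^ dk i * 3 `^ delta i *
    (ps i / rh i * (ps' i / rh' i) + ps' i / rh i) `^ s i)); last first.
  by rewrite [in RHS]big_split/=; ring.
rewrite ler_wpM2l ?fprob_ge0// /Q /B' /B -!big_split/= -prodfV -big_split/=.
apply: ler_prod => i _; rewrite overlap_coordinate andbT.
rewrite !mulr_ge0 ?invr_ge0 ?mulr_ge0 ?invr_ge0 ?powR_ge0 ?(ltW c_gt0)//.
  by rewrite /overlap_bound; case: ifP => _; rewrite !mulr_ge0 ?powR_ge0 ?(ltW c_gt0).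
by rewrite /shadow_bound; case: ifP => _; rewrite !mulr_ge0 ?powR_ge0 ?(ltW c_gt0).
Qed.

End two_layers.

(** Since [y i <= t * b i], the factor [b i] comes out of each base and leaves [a i + t]. In use [b]
    holds the ratios of the earlier stage if [psi] is regular, of the later one if [rho] is. *)
Lemma prod_powR_shift_le (a b y : 'I_d -> R) (t sigma : R) :
  (forall i, 0 <= a i <= 1) -> (forall i, 0 <= b i) ->
  (forall i, 0 <= y i <= t * b i) -> 0 <= t <= 1 ->
  0 <= sigma -> (forall i, s i = 0 \/ sigma <= s i) ->
  \prod_i (b i * a i + y i) `^ s i <=
  \prod_i 2 `^ s i * (\prod_i b i `^ s i * (\prod_i a i `^ s i + t `^ sigma)).
Proof.
move=> a01 b0 yb t01 sg0 ssg.
apply: (@le_trans _ _ (\prod_i b i `^ s i * \prod_i (a i + t) `^ s i)).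
  rewrite -big_split/=; apply: ler_prod => i _; rewrite powR_ge0/=.
  have /andP[a0 _] := a01 i; have /andP[y0 yt] := yb i; have /andP[t0 _] := t01.
  rewrite -powRM//; last exact: addr_ge0.
  apply: ler_powRl; first exact: delta_1Bkappa_ge0.
    by rewrite addr_ge0// mulr_ge0.
  by rewrite mulrDr lerD2l (mulrC (b i)).
rewrite mulrCA ler_wpM2l; [|by apply: prodr_ge0 => i _; exact: powR_ge0|].
  by [].
by apply: prod_powRD_le => // i; exact: delta_1Bkappa_ge0.
Qed.

Lemma regular_wrt_iter (lambda : R) (u : nat -> int) (phi : R -> R) n0 :
  0 <= lambda ->
  (forall n, (n0 <= n)%N -> phi (u n.+1)%:~R <= lambda * phi (u n)%:~R) ->
  forall k n, (n0 <= k)%N -> (k <= n)%N ->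
    phi (u n)%:~R <= lambda ^+ (n - k) * phi (u k)%:~R.
Proof.
move=> l0 H k n nk kn; rewrite -(subnK kn); move: (n - k)%N => j.
rewrite addnK; elim: j => [|j IH]; first by rewrite add0n expr0 mul1r.
rewrite addSn exprS -mulrA.
apply: le_trans (H _ (leq_trans nk (leq_addl _ _))) _.
by rewrite ler_wpM2l.
Qed.

(** * Local density of the limsup set *)

Section density.
Variables (beta : J -> R) (l u : nat -> int) (rho psi : 'I_d -> R -> R)
  (cu lambda sigma : R).
Hypothesis beta_finite : forall M : R, 1 < M -> finite_set [set a | beta a < M].
Hypothesis le_lu : forall n, (1 <= n)%N -> l n <= u n.
Hypothesis l_infty : ((l n)%:~R : R) @[n --> \oo] --> +oo.
Hypothesis rho_cvg0 : forall i, rho i t @[t --> +oo] --> (0 : R).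
Hypothesis psi_gt0 : forall i (t : R), 0 < t -> 0 < psi i t.
Hypothesis psi_nonincreasing : forall i (s t : R), 0 < s -> s <= t ->
  psi i t <= psi i s.
Hypothesis lambda_bounds : 0 < lambda < 1.
Hypothesis psi_or_rho_regular : (forall i, regular_wrt lambda u (psi i)) \/
  (forall i, regular_wrt lambda u (rho i)).
Hypothesis psi_le_rho : \forall n \near \oo,
  forall i, psi i (u n)%:~R <= rho i (u n)%:~R.
Hypothesis cu_gt0 : 0 < cu.
Hypothesis ubiquity : forall (x : forall i, X i) (r : R), 0 < r ->
  \forall n \near \oo, cu * m (pball x r) <= m (pball x r `&`
    \bigcup_(a in window beta l u n)
      rectangle (fun i => nbhd (Res a i) (rho i (u n)%:~R))).
Hypothesis sigma_gt0 : 0 < sigma.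
Hypothesis sigma_le : forall i, s i = 0 \/ sigma <= s i.
Hypothesis divergence : (\sum_(1 <= n <oo)
     (\prod_(i < d) (psi i (u n)%:~R / rho i (u n)%:~R) `^ s i)%:E = +oo)%E.

Local Notation W := (limsup_set Res beta psi).

(** Sublevel sets of [beta] are finite, so infinitely many indices amount to indices with
    arbitrarily large [beta]. The shift to [N.+2] meets the requirement [1 < M] of [beta_finite]. *)
Lemma limsup_setE : W = \bigcap_N \bigcup_(a in [set a | N.+2%:R <= beta a])
  rectangle (fun i => nbhd (Res a i) (psi i (beta a))).
Proof.
apply/seteqP; split => [x /= Wx N _|x Wx /=].
  apply: contrapT => nx; apply: Wx.
  apply: (@sub_finite_set _ _ [set a | beta a < N.+2%:R]).
    move=> a /= xa; rewrite ltNge; apply/negP => Na; apply: nx.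
    by exists a.
  by apply: beta_finite; rewrite ltr1n.
move=> finS; have := finite_image beta finS.
move=> /finite_seqP[q qE].
pose b := \sum_(y <- q) `|y|.
have qb y : y \in q -> y <= b.
  rewrite /b; elim: q {qE b} => // v q IH; rewrite inE big_cons => /orP[/eqP ->|/IH h].
    apply: (le_trans (ler_norm v)); rewrite lerDl; exact: sumr_ge0.
  by apply: (le_trans h); rewrite lerDr.
have [a /= Na xa] := Wx (Num.bound b) I.
have : beta a \in q.
  have : [set` q] (beta a) by rewrite -qE; exists a.
  by [].
move=> /qb; rewrite leNgt => /negP; apply.
apply: lt_le_trans Na; apply: (@lt_trans _ _ (Num.bound b)%:R).
  apply: archi_boundP; exact: sumr_ge0.
by rewrite ltr_nat.
Qed.

Lemma limsup_set_generated : <<s ball_open_set prod_ball >> W.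
Proof.
rewrite limsup_setE; rewrite -[X in <<s _ >> X]setCK setC_bigcap -setTD.
have [_ sC sU] := @smallest_sigma_algebra (prod_space X) setT (ball_open_set prod_ball).
apply: (sC); apply: sU => N; rewrite -setTD; apply: sC.
apply: sub_sigma_algebra; apply: ball_open_set_bigcup => a.
by apply: rectangle_ball_open => i; exact: nbhd_open.
Qed.

Lemma limsup_set_measurable : measurable (W : set (prod_space X)).
Proof.
have [||||||] := @generated_regular _ _ _ P prod_ball _ _ _ _ _ _ _ limsup_set_generated => //.
- exact: pball_center.
- exact: pball_sym.
- exact: pball_triangle.
- exact: pball_ball_open.
- exact: pball_measurable.
- exact: fprob_pball_pos.
Qed.

Let cE := cu / doubling_constant / \prod_(i < d) (c ^+ 2 * 5 `^ delta i).
(** The first-moment constant plus the overlap constant, so that a single [C] serves both upper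
    bounds in [borel_cantelli_local]. *)
Let CE := c ^+ 2 ^+ d +
  \prod_i (c ^+ 4 * 3 `^ dk i * 3 `^ delta i) * \prod_i 2 `^ s i.
Let th := lambda `^ sigma.

Lemma local_density (x0 : forall i, X i) (r : R) : 0 < r -> r < r0 ->
  cE ^+ 2 / (CE * (2 + 4 / (1 - th))) * m (pball x0 r) <= m (W `&` pball x0 r).
Proof.
move=> r_gt0 rr0.
have /andP[l0 l1] := lambda_bounds.
have r2 : 0 < r / 2 by rewrite divr_gt0.
pose rh n i := rho i (u n)%:~R; pose ps n i := psi i (u n)%:~R.
have u_infty : ((u n)%:~R : R) @[n --> \oo] --> +oo.
  apply: ger_cvgy l_infty; near=> n; rewrite ler_int; apply: le_lu.
  by near: n; exact: nbhs_infty_ge.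
have rh_small e : 0 < e -> \forall n \near \oo, forall i, rh n i < e.
  move=> e0; apply: filter_forall => i.
  have h : rh n i @[n --> \oo] --> (0 : R) by apply: cvg_comp u_infty (@rho_cvg0 i).
  exact: cvgr_lt h _ e0.
have l_pos : \forall n \near \oo, 0 < (l n)%:~R :> R.
  by move/cvgryPgt : l_infty; exact.
have reg : (\forall n \near \oo, forall i, ps n.+1 i <= lambda * ps n i) \/
    (\forall n \near \oo, forall i, rh n.+1 i <= lambda * rh n i).
  by case: psi_or_rho_regular => h; [left|right]; apply: filter_forall => i; exact: h.
(* The thresholds [r0 / 7] and [r / 6] are the size conditions on [rh] in the lemmas on layers. *)
have good : \forall n \near \oo, [/\ (1 <= n)%N, 0 < (l n)%:~R :> R,
    forall i, ps n i <= rh n i, forall i, rh n i < Num.min (r0 / 7) (r / 6) &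
    cu * m (pball x0 (r / 2)) <= m (pball x0 (r / 2) `&`
    \bigcup_(a in window beta l u n)
      rectangle (fun i => nbhd (Res a i) (rh n i)))].
  near=> n; split; near: n.
  - exact: nbhs_infty_ge.
  - exact: l_pos.
  - exact: psi_le_rho.
  - by apply: rh_small; rewrite lt_min !divr_gt0.
  - exact: ubiquity.
have [n0 [Hgood Hreg]] : exists n0, (forall n, (n0 <= n)%N -> [/\ (1 <= n)%N, 0 < (l n)%:~R :> R,
    forall i, ps n i <= rh n i, forall i, rh n i < Num.min (r0 / 7) (r / 6) &
    cu * m (pball x0 (r / 2)) <= m (pball x0 (r / 2) `&`
    \bigcup_(a in window beta l u n)
      rectangle (fun i => nbhd (Res a i) (rh n i)))]) /\
    ((forall n, (n0 <= n)%N -> forall i, ps n.+1 i <= lambda * ps n i) \/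
     (forall n, (n0 <= n)%N -> forall i, rh n.+1 i <= lambda * rh n i)).
  have [n1 _ H1] := good.
  case: reg => -[n2 _ H2]; exists (maxn n1 n2); split.
  - by move=> n; rewrite geq_max => /andP[/H1].
  - by left => n; rewrite geq_max => /andP[_ /H2].
  - by move=> n; rewrite geq_max => /andP[/H1].
  - by right => n; rewrite geq_max => /andP[_ /H2].
have lu0 n : (n0 <= n)%N -> 0 < (u n)%:~R :> R.
  by case/Hgood => n1 ln _ _ _; apply: lt_le_trans ln _; rewrite ler_int le_lu.
have ps_gt0 n i : (n0 <= n)%N -> 0 < ps n i by move=> /lu0; exact: psi_gt0.
have ps_le n i : (n0 <= n)%N -> ps n i <= rh n i by case/Hgood => _ _ /(_ i).
have rh_gt0 n i : (n0 <= n)%N -> 0 < rh n i.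
  by move=> n0n; apply: lt_le_trans (ps_le _ _ n0n); exact: ps_gt0.
have rh7 n i : (n0 <= n)%N -> 7 * rh n i < r0.
  by case/Hgood => _ _ _ /(_ i) + _; rewrite lt_min => /andP[+ _]; lra.
have rh6 n i : (n0 <= n)%N -> 6 * rh n i <= r.
  by case/Hgood => _ _ _ /(_ i) + _; rewrite lt_min => /andP[_]; lra.
have layerP n : exists L : layer x0 r (window beta l u n) (rh n) (ps n), (n0 <= n)%N ->
    cu * m (pball x0 (r / 2)) <=
    (layer_size L)%:R * \prod_i (c * (5 * rh n i) `^ delta i).
  have [n0n|n0n] := leqP n0 n.
    have [||||L HL] := @layer_exists x0 r cu (window beta l u n) (rh n) (ps n).
    - by move=> i; exact: rh_gt0.
    - by move=> i; exact: rh7.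
    - by move=> i; exact: rh6.
    - by case: (Hgood n n0n).
    by exists L.
  (* Before [n0] the stage is an empty layer, a default value about which no estimate is claimed. *)
  have z (k : 'I_0) : forall i, X i by case: k.
  have al (k : 'I_0) : J by case: k.
  have h1 (k : 'I_0) : window beta l u n (al k) by case: k.
  have h2 (k : 'I_0) : forall i, Res (al k) i (z k i) by case: k.
  have h3 (k k' : 'I_0) : box (rh n) (z k) `&` box (rh n) (z k') !=set0 -> k = k'.
    by case: k.
  have h4 (k : 'I_0) : box (rh n) (z k) `<=` pball x0 r by case: k.
  by exists (Layer (ps n) h1 h2 h3 h4).
pose L n := projT1 (cid (layerP n)).
have LP n : (n0 <= n)%N -> cu * m (pball x0 (r / 2)) <=
    (layer_size (L n))%:R * \prod_i (c * (5 * rh n i) `^ delta i).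
  by rewrite /L; case: cid.
pose E n : set (prod_space X) := layer_set (L n).
pose q n i := ps n i / rh n i.
have q01 n i : (n0 <= n)%N -> 0 <= q n i <= 1.
  move=> n0n; have h1 := ps_gt0 n i n0n; have h2 := rh_gt0 n i n0n.
  rewrite /q divr_ge0 ?(ltW h1) ?(ltW h2)//= ler_pdivrMr// mul1r.
  exact: ps_le.
pose p n := \prod_i q n i `^ s i.
have p0 n : 0 <= p n by apply: prodr_ge0 => i _; exact: powR_ge0.
have cE0 : 0 < cE.
  rewrite !divr_gt0 ?doubling_constant_gt0//.
  by apply: prodr_gt0 => i _; rewrite mulr_gt0 ?exprn_gt0 ?powR_gt0.
have CE1 : 0 <= c ^+ 2 ^+ d by rewrite !exprn_ge0// ltW.
set CI := \prod_i (c ^+ 4 * 3 `^ dk i * 3 `^ delta i).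
set C2 := \prod_i 2 `^ s i.
have C20 : 0 < C2 by apply: prodr_gt0 => i _; exact: powR_gt0.
have CI0 : 0 < CI.
  by apply: prodr_gt0 => i _; rewrite !mulr_gt0 ?exprn_gt0 ?powR_gt0.
have th_gt0 : 0 < th by exact: powR_gt0.
have th1 : th < 1.
  rewrite -(powRr0 lambda) /th; rewrite /powR (gt_eqF l0) ltr_expR mul0r.
  by rewrite pmulr_rlt0// ln_lt0// l0.
have thX k : (lambda ^+ k) `^ sigma = th ^+ k.
  by rewrite /th -!powR_mulrn ?powR_ge0 ?(ltW l0)// -!powRrM mulrC.
have lX k : 0 <= lambda ^+ k <= 1.
  by rewrite exprn_ge0 ?(ltW l0)//= exprn_ile1 ?(ltW l0) ?(ltW l1).
have mB0 : 0 <= m (pball x0 r) by exact: fprob_ge0.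
have main := @borel_cantelli_local R _ (prod_space X) P E p n0 cE CE th
  (m (pball x0 r)).
apply: (le_trans (main _ _ _ _ _ _ _ _ _ _ _ _)) => //.
- by rewrite ltr_wpDl// mulr_gt0.
- exact: ltW.
- by move=> n; exact: layer_set_measurable.
- move=> n n0n; apply: prodr_ile1 => i _; rewrite powR_ge0/=.
  have /andP[q0 q1] := q01 n i n0n.
  by have := ler_powRl (delta_1Bkappa_ge0 i) q0 q1; rewrite powR1.
- move=> n n0n; apply: fprob_layer_set_ge => //.
  + by move=> i; exact: ps_gt0.
  + by move=> i; exact: ps_le.
  + by move=> i; exact: rh7.
  + exact: LP.
- move=> n n0n.
  apply: (le_trans (@fprob_layer_set_le x0 r _ (rh n) (ps n) _ _ _ (L n))).
  + by move=> i; exact: ps_gt0.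
  + by move=> i; exact: ps_le.
  + by move=> i; exact: rh7.
  + apply: ler_wpM2r; first exact: p0.
    apply: ler_wpM2r => //.
    by rewrite lerDl; apply: mulr_ge0; exact: ltW.
- move=> k n n0k kn.
  have n0n : (n0 <= n)%N by exact: leq_trans n0k (ltnW kn).
  have ratio : (forall i, ps n i <= lambda ^+ (n - k) * ps k i) \/
      (forall i, rh n i <= lambda ^+ (n - k) * rh k i).
    case: Hreg => H; [left|right] => i.
      exact: (@regular_wrt_iter lambda u (psi i) n0 (ltW l0)
        (fun j nj => H j nj i) k n n0k (ltnW kn)).
    exact: (@regular_wrt_iter lambda u (rho i) n0 (ltW l0)
        (fun j nj => H j nj i) k n n0k (ltnW kn)).
  have /andP[lX0 lX1] := lX (n - k)%N.
  (* Either kind of regularity yields this comparison, which the overlap estimate assumes. *)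
  have ps_rh i : ps n i <= rh k i.
    case: ratio => /(_ i) H.
      apply: (le_trans H); apply: le_trans (ps_le _ _ n0k).
      by rewrite ler_piMl// ltW// ps_gt0.
    apply: (le_trans (ps_le _ _ n0n)); apply: (le_trans H).
    by rewrite ler_piMl// ltW// rh_gt0.
  apply: (le_trans (@fprob_layer_setI x0 r _ _ (rh k) (ps k) (rh n) (ps n)
    _ _ _ _ _ _ _ (L k) (L n))).
  + by move=> i; exact: ps_gt0.
  + by move=> i; exact: ps_le.
  + by move=> i; exact: rh7.
  + by move=> i; exact: ps_gt0.
  + by move=> i; exact: ps_le.
  + by move=> i; exact: rh7.
  + by [].
  have y0 i : 0 <= ps n i / rh k i by rewrite divr_ge0 ?(ltW (ps_gt0 _ _ n0n)) ?(ltW (rh_gt0 _ _ n0k)).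
  have cross : \prod_i (q k i * q n i + ps n i / rh k i) `^ s i <=
      C2 * (p k * p n + th ^+ (n - k) * (p k + p n)).
    have th0' : 0 <= th ^+ (n - k) by rewrite exprn_ge0// ltW.
    (* The factor taken out is [p k] in the first case and [p n] in the second; the other half of
       [th ^+ (n - k) * (p k + p n)] is nonnegative and is added for symmetry. *)
    case: ratio => H.
      apply: (le_trans (@prod_powR_shift_le (q n) (q k) (fun i => ps n i / rh k i)
         (lambda ^+ (n - k)) sigma _ _ _ _ _ _)) => //.
      - by move=> i; exact: q01.
      - by move=> i; case/andP: (q01 k i n0k).
      - move=> i; rewrite y0/= /q mulrA; apply: ler_wpM2r; last exact: H.
        by rewrite invr_ge0 (ltW (rh_gt0 _ _ n0k)).
      - exact: ltW.
      rewrite thX ler_wpM2l ?(ltW C20)//.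
      have := p0 k; have := p0 n; rewrite -/(p k) -/(p n); nra.
    under eq_bigr do rewrite mulrC.
    apply: (le_trans (@prod_powR_shift_le (q k) (q n) (fun i => ps n i / rh k i)
       (lambda ^+ (n - k)) sigma _ _ _ _ _ _)) => //.
    - by move=> i; exact: q01.
    - by move=> i; case/andP: (q01 n i n0n).
    - move=> i; rewrite y0/= /q mulrCA; apply: ler_wpM2l; first exact: ltW (ps_gt0 _ _ n0n).
      by rewrite ler_pdivlMr ?rh_gt0// [leLHS]mulrC ler_pdivrMr ?rh_gt0.
    - exact: ltW.
    rewrite thX ler_wpM2l ?(ltW C20)//.
    have := p0 k; have := p0 n; rewrite -/(p k) -/(p n); nra.
  apply: (le_trans (ler_wpM2l _ cross)); first by rewrite mulr_ge0// ltW.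
  rewrite [leLHS](_ : _ = (CI * C2) * (m (pball x0 r) *
     (p k * p n + th ^+ (n - k) * (p k + p n)))); last by rewrite -/CI; ring.
  rewrite -[leRHS]mulrA; apply: ler_wpM2r; last by rewrite lerDr.
  apply: mulr_ge0 => //; apply: addr_ge0; first exact: mulr_ge0.
  by apply: mulr_ge0; [rewrite exprn_ge0// ltW|exact: addr_ge0].
have mE n : measurable (E n) by exact: layer_set_measurable.
apply: fprob_le.
- by apply: bigcap_measurable => // N _; exact: bigcup_measurable.
- by apply: measurableI; [exact: limsup_set_measurable|exact: pball_measurable].
move=> x Ex; split; last first.
  by have [n _ Enx] := Ex 0%N I; exact: layer_set_subset Enx.
rewrite limsup_setE => N _.
have [n1 _ Hl] : \forall n \near \oo, N.+2%:R <= (l n)%:~R :> R.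
  by move/cvgryPge : l_infty; exact.
have [n /= + [k _ Ax]] := Ex (maxn n0 n1) I; rewrite geq_max => /andP[n0n n1n].
have [la au] := @layer_window _ _ _ _ _ (L n) k.
have lN := Hl n n1n.
exists (layer_index (L n) k); first exact: le_trans lN la.
(* Indices in the window satisfy [beta a <= u n], so monotonicity of [psi] enlarges the
   neighbourhood to radius [psi i (beta a)]; this places the limsup of the stages inside [W]. *)
move=> i; have [_ /nbhd_le] := Ax i; apply.
apply: psi_nonincreasing => //; apply: lt_le_trans la.
by apply: lt_le_trans lN.
Unshelve. all: by end_near.
Qed.

End density.

End layers.
End product_measure.

(** * Full measure *)

(** The inverse of [1 + \sum_i (f i)^-1] works; zero values contribute nothing since [0^-1 = 0].
    This supplies both [sigma] and a common radius. *)
Lemma uniform_lower_bound (R : realType) (I : finType) (f : I -> R) :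
  (forall i, 0 <= f i) -> exists2 e, 0 < e & forall i, f i = 0 \/ e <= f i.
Proof.
move=> f0; pose S := 1 + \sum_i (f i)^-1.
have S0 : 0 < S by rewrite ltr_pwDl// sumr_ge0// => i _; rewrite invr_ge0.
exists S^-1; first by rewrite invr_gt0.
move=> i; have [->|fi] := eqVneq (f i) 0; [by left|right].
have fi0 : 0 < f i by rewrite lt_def fi f0.
rewrite -[leRHS]invrK lef_pV2 ?posrE ?invr_gt0// /S (bigD1 i)//= addrCA lerDl.
by rewrite addr_ge0// sumr_ge0// => j _; rewrite invr_ge0.
Qed.

(** [Q] survives enlarging [c] and shrinking [r], so one plus the sum of the [c] and a positive
    lower bound for the [r] serve all indices. *)
Lemma uniform_constants (R : realType) (I : finType) (Q : I -> R -> R -> Prop) :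
  (forall i c c' r r', Q i c r -> 0 < c -> c <= c' -> r' <= r -> Q i c' r') ->
  (forall i, exists c r, [/\ 0 < c, 0 < r & Q i c r]) ->
  exists c r, [/\ 0 < c, 0 < r & forall i, Q i c r].
Proof.
move=> Qmono h.
have /choice[cr crP] : forall i, exists cr : R * R, [/\ 0 < cr.1, 0 < cr.2 & Q i cr.1 cr.2].
  by move=> i; have [c [r ?]] := h i; exists (c, r).
have [r r0 rP] := @uniform_lower_bound R I (fun i => (cr i).2)
  (fun i => ltW (let: And3 _ h _ := crP i in h)).
exists (1 + \sum_i (cr i).1), r; split => //.
  by rewrite ltr_pwDl// sumr_ge0// => i _; case: (crP i) => /ltW.
move=> i; have [c0 r0i Qi] := crP i; apply: Qmono Qi c0 _ _.
  rewrite (bigD1 i)//= addrCA lerDl addr_ge0// sumr_ge0// => j _.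
  by case: (crP j) => /ltW.
by have [ri|] := rP i; first by move: r0i; rewrite ri ltxx.
Qed.

(** A negative exponent would push the lower Ahlfors bound above 1 at small radii. *)
Lemma ahlfors_exponent_ge0 (R : realType) (X : pmetricType R)
  (nu : probability (borel X) R) (delta : R) :
  ahlfors_regular nu delta -> 0 <= delta.
Proof.
move=> [c [r0 [c0 r00 H]]]; rewrite leNgt; apply/negP => d0.
(* At radius [e] the lower bound [c^-1 * e ^ delta] equals 2. *)
pose e : R := (2 * c)^-1 `^ (- delta)^-1.
have e0 : 0 < e by rewrite powR_gt0// invr_gt0 mulr_gt0.
pose r := Num.min (r0 / 2) e.
have r_gt0 : 0 < r by rewrite lt_min e0 divr_gt0.
have rr0 : r < r0 by rewrite /r gt_min; apply/orP; left; lra.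
have [h _] := H point r r_gt0 rr0.
have mB : measurable (ball (point : X) r : set (borel X)).
  by apply: open_borel_measurable; exact: mball_open.
have := le_trans h (probability_le1 nu mB).
rewrite lee_fin ler_pdivrMl// mulr1 -[delta]opprK powRN.
rewrite invf_ple ?posrE ?powR_gt0//; apply/negP; rewrite -ltNge.
have d0' : 0 < - delta by rewrite oppr_gt0.
have : r `^ (- delta) <= e `^ (- delta).
  by apply: ler_powRl; [exact: ltW|exact: ltW|rewrite /r ge_min lexx orbT].
move/le_lt_trans; apply.
rewrite /e -powRrM mulVf ?gt_eqF// powRr1 ?invr_ge0 ?mulr_ge0 ?(ltW c0)//.
by rewrite ltf_pV2 ?posrE ?mulr_gt0//; lra.
Qed.

Section total_mass_one.
Context {d : measure_display} {T : measurableType d} {R : realType}.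
Variable mu : {measure set T -> \bar R}.

(* Carries the instance making a measure of total mass 1 a [probability]. *)
Definition total_mass_one of mu setT = 1%E := (mu : set T -> \bar R).

Variable muT : mu setT = 1%E.
HB.instance Definition _ := Measure.copy (total_mass_one muT) mu.
HB.instance Definition _ :=
  Measure_isProbability.Build _ _ _ (total_mass_one muT) muT.

End total_mass_one.

Unset Implicit Arguments.

Theorem theorem2p5 (R : realType) (d : nat) (hd : (1 <= d)%N)
  (X : 'I_d -> pmetricType R)
  (X_bounded : forall i, bounded_space (X i))
  (X_loc_compact : forall i, locally_compact [set: X i])
  (mu_ : forall i, probability (borel (X i)) R)
  (mu : {measure set (prod_space X) -> \bar R})
  (mu_prod : is_product_measure mu_ mu)
  (J : Type) (J_countable : countable [set: J])
  (J_infinite : infinite_set [set: J])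
  (beta : J -> R) (beta_ge0 : forall a, 0 <= beta a)
  (beta_finite : forall M : R, 1 < M -> finite_set [set a | beta a < M])
  (l u : nat -> int) (le_lu : forall n, (1 <= n)%N -> l n <= u n)
  (l_infty : ((l n)%:~R : R) @[n --> \oo] --> +oo)
  (rho : 'I_d -> R -> R)
  (rho_ge0 : forall i (t : R), 0 < t -> 0 <= rho i t)
  (rho_cvg0 : forall i, rho i t @[t --> +oo] --> (0 : R))
  (Res : J -> forall i, set (X i))
  (psi : 'I_d -> R -> R)
  (psi_gt0 : forall i (t : R), 0 < t -> 0 < psi i t)
  (delta kappa : 'I_d -> R)
  (mu_regular : forall i, ahlfors_regular (mu_ i) (delta i))
  (kappa_bounds : forall i, 0 <= kappa i < 1)
  (Res_scaling : forall i,
     scaling_property (mu_ i) (delta i) (kappa i) (fun a => Res a i))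
  (Res_ubiquitous : ubiquitous_rectangles mu Res beta rho l u)
  (psi_nonincreasing : forall i (s t : R), 0 < s -> s <= t ->
     psi i t <= psi i s)
  (lambda : R) (lambda_bounds : 0 < lambda < 1)
  (psi_or_rho_regular : (forall i, regular_wrt lambda u (psi i)) \/
                        (forall i, regular_wrt lambda u (rho i)))
  (psi_le_rho : \forall n \near \oo,
     forall i, psi i (u n)%:~R <= rho i (u n)%:~R) :
  (\sum_(1 <= n <oo)
     (\prod_(i < d) (psi i (u n)%:~R / rho i (u n)%:~R)
                      `^ (delta i * (1 - kappa i)))%:E = +oo)%E ->
  mu (limsup_set Res beta psi) = mu [set: forall i, X i].
Proof.
move=> divergence.
have muT : mu setT = 1%E.
  (* [mu] is only given as a measure; its total mass is read off from the whole space seen as a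
     rectangle. *)
  rewrite [X in mu X](_ : _ = rectangle (fun i => [set: X i])); last first.
    by apply/seteqP; split.
  rewrite mu_prod//; under eq_bigr do rewrite probability_setT.
  by rewrite big1.
pose P : probability (prod_space X) R := total_mass_one muT.
have delta_ge0 i := ahlfors_exponent_ge0 (mu_regular i).
(* Ahlfors regularity and scaling are bundled so that one pair of constants serves both, in all
   coordinates. *)
pose Q i (c r0 : R) :=
  (forall (x : X i) (r : R), 0 < r -> r < r0 ->
    c^-1 * r `^ delta i <= fprob (mu_ i) (ball x r) <= c * r `^ delta i) /\
  (forall a (x : X i) (r e : R), Res a i x -> r < r0 -> 0 < e -> e < r ->
  c^-1 * (r `^ (delta i * kappa i) * e `^ (delta i * (1 - kappa i))) <=
    fprob (mu_ i) (ball x r `&` nbhd (Res a i) e) <=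
  c * (r `^ (delta i * kappa i) * e `^ (delta i * (1 - kappa i)))).
have [c [r0 [c_gt0 r0_gt0 cP]]] : exists c r, [/\ 0 < c, 0 < r & forall i, Q i c r].
  have weaken (b c c' v : R) : 0 <= b -> 0 < c -> c <= c' ->
      c^-1 * b <= v <= c * b -> c'^-1 * b <= v <= c' * b.
    move=> b0 c0 cc' /andP[h1 h2]; apply/andP; split.
      apply: le_trans h1; rewrite ler_wpM2r// lef_pV2 ?posrE//.
      exact: lt_le_trans cc'.
    by apply: (le_trans h2); rewrite ler_wpM2r.
  apply: uniform_constants => [i c c' r r' [H1 H2] c0 cc' rr'|i].
    split=> [x s s0 sr'|a x s e ax sr' e0 es].
      by apply: weaken c0 cc' (H1 _ _ s0 (lt_le_trans sr' rr')); exact: powR_ge0.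
    apply: weaken c0 cc' (H2 _ _ _ _ ax (lt_le_trans sr' rr') e0 es).
    by rewrite mulr_ge0 ?powR_ge0.
  have [c1 [r1 [c10 r10 H1]]] := mu_regular i.
  have [c2 [r2 [c20 r20 H2]]] := Res_scaling i.
  exists (Num.max c1 c2), (Num.min r1 r2); split.
  - by rewrite lt_max c10.
  - by rewrite lt_min r10.
  - split=> [x r r_gt0|a x r e ax].
    + rewrite lt_min => /andP[rr1 _].
      apply: (@weaken _ c1) => //; first exact: powR_ge0.
        by rewrite le_max lexx.
      have [] := H1 x r r_gt0 rr1.
      rewrite fprobE; last by apply: open_borel_measurable; exact: mball_open.
      by rewrite !lee_fin => -> ->.
    + rewrite lt_min => /andP[_ rr2] e0 er.
      apply: (@weaken _ c2) => //; first by rewrite mulr_ge0 ?powR_ge0.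
        by rewrite le_max lexx orbT.
      have [] := H2 a x r e ax rr2 e0 er.
      rewrite fprobE; last first.
        apply: open_borel_measurable; apply: openI; [exact: mball_open|exact: nbhd_open].
      by rewrite !lee_fin => -> ->.
have ahl i := (cP i).1.
have sca i := (cP i).2.
have [sigma sigma0 sigmaP] := @uniform_lower_bound R 'I_d
  (fun i => delta i * (1 - kappa i)) (delta_1Bkappa_ge0 delta_ge0 kappa_bounds).
have [cu [cu0 ubiq]] := Res_ubiquitous.
have P_prod : is_product_measure mu_ P by [].
have P_pos := fprob_pball_pos P_prod c_gt0 r0_gt0 ahl.
have P_open := prod_ball_open_measurable P_prod c_gt0 r0_gt0 ahl.
have ubiqR (x : forall i, X i) (r : R) : 0 < r ->
  \forall n \near \oo, cu * fprob P (pball x r) <= fprob P (pball x r `&`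
    \bigcup_(a in window beta l u n)
      rectangle (fun i => nbhd (Res a i) (rho i (u n)%:~R))).
  move=> r_gt0; have := ubiq x r r_gt0; apply: filterS => n.
  have mB := pball_measurable x r.
  (* Passing to real values needs this set measurable; the union is open for the product balls. *)
  have mU : measurable (pball x r `&`
    \bigcup_(a in window beta l u n)
      rectangle (fun i => nbhd (Res a i) (rho i (u n)%:~R)) : set (prod_space X)).
    apply: measurableI => //; apply: P_open.
    apply: ball_open_set_bigcup => a; apply: rectangle_ball_open => i.
    exact: nbhd_open.
  by move=> h; rewrite -lee_fin EFinM -!fprobE.
have dens := local_density P_prod delta_ge0 c_gt0 r0_gt0 ahl kappa_bounds sca beta_finite
  le_lu l_infty rho_cvg0 psi_gt0 psi_nonincreasing lambda_bounds
  psi_or_rho_regular psi_le_rho cu0 ubiqR sigma0 sigmaP divergence.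
have gW := limsup_set_generated Res psi beta_finite.
have [lambda_gt0 lambda_lt1] := andP lambda_bounds.
have th1 : lambda `^ sigma < 1.
  rewrite /powR (gt_eqF lambda_gt0) -expR0 ltr_expR.
  by rewrite pmulr_rlt0// ln_lt0// lambda_gt0.
have K_gt0 : 0 < (cu / doubling_constant delta c /
     \prod_(i < d) (c ^+ 2 * 5 `^ delta i)) ^+ 2 /
   ((c ^+ 2 ^+ d + \prod_(i < d) (c ^+ 4 * 3 `^ (delta i * kappa i) * 3 `^ delta i) *
       \prod_(i < d) 2 `^ (delta i * (1 - kappa i))) *
    (2 + 4 / (1 - lambda `^ sigma))).
  rewrite divr_gt0 ?exprn_gt0 ?divr_gt0 ?doubling_constant_gt0//.
    by apply: prodr_gt0 => i _; rewrite mulr_gt0 ?exprn_gt0 ?powR_gt0.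
  rewrite mulr_gt0// addr_gt0// ?exprn_gt0// ?divr_gt0 ?subr_gt0//.
  rewrite mulr_gt0//; apply: prodr_gt0 => i _; last exact: powR_gt0.
  by rewrite !mulr_gt0 ?exprn_gt0 ?powR_gt0.
have W1 : fprob P (limsup_set Res beta psi) = 1.
  apply: (@full_of_uniform_density R _ (prod_space X) P prod_ball _ _ _ _ _ _
    _ (doubling_constant delta c) _ r0 _ K_gt0 r0_gt0 _ gW dens).
  - exact: pball_center.
  - exact: pball_sym.
  - by move=> x y z r s; exact: pball_triangle.
  - exact: pball_ball_open.
  - exact: pball_measurable.
  - exact: P_pos.
  - exact: doubling_constant_gt0.
  - by move=> x r; exact: (fprob_pball_doubling P_prod c_gt0 ahl).
have mW : measurable (limsup_set Res beta psi : set (prod_space X)).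
  exact: (limsup_set_measurable P_prod c_gt0 r0_gt0 ahl Res psi beta_finite).
rewrite muT; have := fprobE P mW; rewrite W1; exact.
Qed.
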